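(* As $d\to\infty$, $$p_{shield}(d)\sim\frac{\log d}{2d},$$ that is, $\displaystyle\lim_{d\to\infty}\frac{p_{shield}(d)}{(\log d)/(2d)}=1$.
   Context: Let $\mathcal{E}^d$ be the set of nearest-neighbor edges of $\mathbb{Z}^d$. For $p\in[0,1]$, $\mathbb{P}_p$ is the product measure on $\{0,1\}^{\mathcal{E}^d}$ under which each edge $e$ is independently open ($\omega(e)=1$) with probability $p$ and closed ($\omega(e)=0$) with probability $1-p$. A path is an alternating sequence of vertices and edges $v_0,e_0,v_1,e_1,\dots$ in which $e_i\in\mathcal{E}^d$ has endpoints $v_i$ and $v_{i+1}$. A vertex $x\in\mathbb{Z}^d$ is shielded if all $2d$ edges incident to $x$ are closed. A shielded path is a path all of whose vertices are shielded; an infinite shielded path is understood to be an infinite vertex self-avoiding one (vertices $v_0,v_1,v_2,\dots$ all distinct). Define $$p_{shield}(d)=\sup\{p\in[0,1]:\mathbb{P}_p(\text{there exists an infinite shielded path})>0\}.$$ Here $\log$ is the natural logarithm, and $a_n\sim b_n$ means $a_n/b_n\to1$. *)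

(* Defs.v *)
From HB Require Import structures.
From mathcomp Require Import all_boot all_order all_algebra.
From mathcomp Require Import finmap.
From mathcomp Require Import all_classical all_reals all_analysis.
From mathcomp Require Import measurable_realfun.
Import numFieldNormedType.Exports.
Import Order.TTheory GRing.Theory Num.Theory.

Set Implicit Arguments.
Unset Strict Implicit.
Unset Printing Implicit Defensive.

Local Open Scope classical_set_scope.
Local Open Scope ring_scope.

Definition coordinate_sets (E : countType) : set (set (E -> bool)) :=
  [set A | exists e b, A = [set w | w e = b]].

(* {0,1}^E with the product sigma-algebra; [true] means open. *)
Definition config (E : countType) := g_sigma_algebraType (@coordinate_sets E).

Definition is_bernoulli_product (R : realType) (E : countType) (p : R)
    (P : probability (config E) R) : Prop :=
  forall (F : {fset E}) (eta : E -> bool),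
    P [set w : config E | forall e, e \in F -> w e = eta e] =
    (\prod_(e <- F) (if eta e then p else 1 - p))%:E.

(* The product measure is obtained as an image of Lebesgue measure on [0,1[:
   at each step the current interval [a, a + w[ is cut at the point a + w p,
   the n-th digit of x being [true] when x falls in the left part at step n. *)
Fixpoint digit (R : realType) (p : R) (n : nat) (a w x : R) : bool :=
  if n is m.+1 then
    if x < a + w * p then digit p m a (w * p) x
    else digit p m (a + w * p) (w * (1 - p)) x
  else x < a + w * p.

Lemma measurable_digit (R : realType) (p : R) n a w :
  measurable_fun [set: R] (digit p n a w).
Proof.
elim: n a w => [|n IHn] a w /=; first exact: measurable_fun_ltr.
apply: measurable_fun_ifT; [exact: measurable_fun_ltr|exact: IHn|exact: IHn].
Qed.

Definition digit_cyl (R : realType) (p : R) n (F : pred nat) (eta : nat -> bool)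
    (a w : R) : set R :=
  [set x | (x \in `[a, a + w[) /\
           forall i, (i < n)%N -> F i -> digit p i a w x = eta i].

Lemma measurable_digit_cyl (R : realType) (p : R) n F eta a w :
  measurable (@digit_cyl R p n F eta a w).
Proof.
have -> : @digit_cyl R p n F eta a w = `[a, a + w[ `&`
    \bigcap_(i in [set i | (i < n)%N /\ F i]) (digit p i a w @^-1` [set eta i]).
  apply/seteqP; split=> x /=.
    by move=> [xa xF]; split => // i [/= ni Fi]; exact: xF.
  by move=> [xa xF]; split => // i ni Fi; apply: xF.
apply: measurableI; first exact: measurable_itv.
apply: bigcap_measurableType => i _.
by rewrite -[X in measurable X]setTI; apply: measurable_digit.
Qed.

Lemma lebesgue_digit_cyl (R : realType) (p : R) n F eta a w :
  0 <= p -> p <= 1 -> 0 <= w ->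
  lebesgue_measure (@digit_cyl R p n F eta a w) =
  (w * \prod_(i < n | F i) (if eta i then p else 1 - p))%:E.
Proof.
move=> p0 p1; elim: n F eta a w => [|n IHn] F eta a w w0.
  rewrite big_ord0 mulr1.
  have -> : digit_cyl p 0 F eta a w = `[a, a + w[%classic.
    by apply/seteqP; split=> x /=; [case|split].
  rewrite lebesgue_measure_itv /= lte_fin ltrDl.
  case: ltP => [_|w_le0]; first by rewrite -EFinD addrAC subrr add0r.
  by have -> : w = 0 by apply/eqP; rewrite eq_le w_le0.
have q0 : 0 <= 1 - p by rewrite subr_ge0.
pose F' i := F i.+1; pose eta' i := eta i.+1.
pose L := digit_cyl p n F' eta' a (w * p).
pose K := digit_cyl p n F' eta' (a + w * p) (w * (1 - p)).
have aw : a + w * p + w * (1 - p) = a + w.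
  by rewrite -addrA -mulrDr addrCA subrr addr0 mulr1.
have wp : a + w * p <= a + w.
  by rewrite lerD2l ler_piMr.
have ap : a <= a + w * p by rewrite lerDl mulr_ge0.
have Ldef x : digit_cyl p n.+1 F eta a w x /\ x < a + w * p <->
    L x /\ (F 0%N -> eta 0%N).
  split=> [[[xa xF] xp]|[[xa xF] h]].
    split.
      split; first by move: xa; rewrite !in_itv /= xp => /andP[->].
      by move=> i ni Fi; have /= := xF i.+1 ni Fi; rewrite xp.
    by move=> F0; have /= := xF 0%N isT F0; rewrite xp.
  move: xa; rewrite in_itv /= => /andP[ax xp].
  split=> //; split; first by rewrite in_itv /= ax (lt_le_trans xp).
  by case=> [|i] /= ni Fi; rewrite xp; [rewrite h|exact: xF].
have Kdef x : digit_cyl p n.+1 F eta a w x /\ ~ (x < a + w * p) <->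
    K x /\ (F 0%N -> ~~ eta 0%N).
  split=> [[[xa xF] /negP xp]|[[xa xF] h]].
    split.
      split; first by move: xa; rewrite !in_itv /= aw [a + w * p <= x]leNgt xp => /andP[_ ->].
      by move=> i ni Fi; have /= := xF i.+1 ni Fi; rewrite (negbTE xp).
    by move=> F0; have /= := xF 0%N isT F0; rewrite (negbTE xp) => <-.
  move: xa; rewrite in_itv /= aw => /andP[xp xw].
  have xpF : (x < a + w * p) = false by rewrite ltNge xp.
  rewrite xpF; split=> //; split.
    by rewrite in_itv /= xw (le_trans ap).
  by case=> [|i] /= ni Fi; rewrite xpF; [rewrite (negbTE (h Fi))|exact: xF].
have LE : lebesgue_measure L =
    (w * p * \prod_(i < n | F i.+1) (if eta i.+1 then p else 1 - p))%:E.
  by rewrite /L IHn // mulr_ge0.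
have KE : lebesgue_measure K =
    (w * (1 - p) * \prod_(i < n | F i.+1) (if eta i.+1 then p else 1 - p))%:E.
  by rewrite /K IHn // mulr_ge0.
have mL : measurable L := measurable_digit_cyl _ _ _ _ _ _.
have mK : measurable K := measurable_digit_cyl _ _ _ _ _ _.
rewrite big_mkcond big_ord_recl -big_mkcond /=.
have [F0|F0] := boolP (F 0%N).
  case: ifP => e0.
    have -> : digit_cyl p n.+1 F eta a w = L.
      apply/seteqP; split=> x; last by move=> Lx; apply: (proj1 (proj2 (Ldef x) _)).
      move=> xc; have [xp|xp] := boolP (x < a + w * p).
        by case: (proj1 (Ldef x) (conj xc xp)).
      by case: (proj1 (Kdef x) (conj xc (negP xp))) => _ /(_ F0); rewrite e0.
    by rewrite LE mulrA.
  have -> : digit_cyl p n.+1 F eta a w = K.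
    apply/seteqP; split=> x; last first.
      by move=> Kx; apply: (proj1 (proj2 (Kdef x) _)); rewrite e0.
    move=> xc; have [xp|xp] := boolP (x < a + w * p).
      by case: (proj1 (Ldef x) (conj xc xp)) => _ /(_ F0); rewrite e0.
    by case: (proj1 (Kdef x) (conj xc (negP xp))).
  by rewrite KE mulrA.
have -> : digit_cyl p n.+1 F eta a w = L `|` K.
  apply/seteqP; split=> x.
    move=> xc; have [xp|xp] := boolP (x < a + w * p).
      by left; case: (proj1 (Ldef x) (conj xc xp)).
    by right; case: (proj1 (Kdef x) (conj xc (negP xp))).
  by case=> h; [have := proj2 (Ldef x)|have := proj2 (Kdef x)] => H;
    apply: (proj1 (H _)); split=> //; rewrite (negbTE F0).
rewrite measureU //; last first.
  rewrite -subset0 => x [[xL _] [xK _]]; move: xL xK; rewrite !in_itv /=.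
  by move=> /andP[_ xp] /andP[]; rewrite leNgt xp.
by rewrite [X in (X + _)%E = _]LE [X in (_ + X)%E = _]KE -EFinD -mulrDl
  -mulrDr [p + _]addrCA subrr addr0 mulr1 mul1r.
Qed.

Section bernoulli_product.
Context (R : realType) (E : countType).
Variable p : R.

Let unif : {measure set (measurableTypeR R) -> \bar R} := mrestr (@lebesgue_measure R) (measurable_itv `[(0 : R), 1[).

Let unifT : unif [set: R] = 1%E.
Proof.
by rewrite /unif /= /mrestr setTI lebesgue_measure_itv /= lte_fin ltr01 sube0.
Qed.

Let f (x : R) : config E := fun e => digit p (choice.pickle e) 0 1 x.

Let mf : measurable_fun [set: R] f.
Proof.
apply: (@measurability _ _ _ (config E) _ f (@coordinate_sets E) erefl).
move=> _ [_ [e [b ->]] <-].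
rewrite setTI.
have -> : f @^-1` [set w : config E | w e = b] =
    digit p (choice.pickle e) 0 1 @^-1` [set b] by [].
by rewrite -[X in measurable X]setTI; apply: measurable_digit.
Qed.

Let Q := pushforward unif f.

Let Q0 : Q set0 = 0%E. Proof. by rewrite /Q /pushforward preimage_set0 measure0. Qed.
Let Qge0 A : (0 <= Q A)%E. Proof. exact: measure_ge0. Qed.
Let Qsigma : semi_sigma_additive Q.
Proof.
move=> G mG tG mUG; rewrite /Q /pushforward preimage_bigcup.
apply: measure_semi_sigma_additive.
- by move=> n; rewrite -[X in measurable X]setTI; exact: mf.
- apply/trivIsetP => /= i j _ _ ij; rewrite -preimage_setI.
  by move/trivIsetP : tG => /(_ _ _ _ _ ij) ->//; rewrite preimage_set0.
- by rewrite -preimage_bigcup -[X in measurable X]setTI; exact: mf.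
Qed.
Let QT : Q setT = 1%E. Proof. by rewrite /Q /pushforward preimage_setT unifT. Qed.

Lemma bernoulli_product_exists :
  exists P : probability (config E) R, 0 <= p <= 1 -> is_bernoulli_product p P.
Proof.
pose mQ := isMeasure.Build _ _ _ Q Q0 Qge0 Qsigma.
pose M : {measure set (config E) -> \bar R} := HB.pack Q mQ.
pose pQ := Measure_isProbability.Build _ _ _ M QT.
pose P : probability (config E) R := HB.pack Q mQ pQ.
exists P => /andP[p0 p1] F eta; rewrite /P /= /Q /pushforward /= /unif /mrestr.
pose s := [seq choice.pickle e | e <- F].
pose n := (\max_(i <- s) i).+1.
pose eta' i := oapp eta false (choice.unpickle i).
have us : uniq s by rewrite map_inj_uniq ?fset_uniq //; exact: (pcan_inj choice.pickleK).
have sn i : i \in s -> (i < n)%N by move=> si; rewrite ltnS; apply: leq_bigmax_seq.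
transitivity (lebesgue_measure (digit_cyl p n [in s] eta' 0 1)).
  congr (lebesgue_measure _).
  apply/seteqP; split=> x /=.
    move=> [xF x01]; split; first by rewrite add0r.
    by move=> i ni /mapP[e eF ->]; rewrite /eta' choice.pickleK /=; exact: xF.
  move=> [x01 xF]; split; last by rewrite add0r in x01.
  move=> e eF; have se : choice.pickle e \in s by exact: map_f.
  by have := xF _ (sn _ se) se; rewrite /eta' choice.pickleK.
rewrite lebesgue_digit_cyl // mul1r; congr EFin.
transitivity (\prod_(i <- s) (if eta' i then p else 1 - p)); last first.
  by rewrite big_map; apply: eq_bigr => e _; rewrite /eta' choice.pickleK.
rewrite -(big_mkord [in s] (fun i => if eta' i then p else 1 - p)) -big_filter.
apply: perm_big; apply: uniq_perm => //.
  by rewrite filter_uniq // iota_uniq.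
move=> i; rewrite mem_filter mem_index_iota /=.
by case si: (i \in s) => //=; rewrite sn.
Qed.

Lemma bernoulli_product_unique (P P' : probability (config E) R) :
  is_bernoulli_product p P -> is_bernoulli_product p P' ->
  forall A, measurable A -> P A = P' A.
Proof.
move=> hP hP'.
pose cyl (F : {fset E}) (eta : E -> bool) : set (config E) :=
  [set w | forall e, e \in F -> w e = eta e].
pose G : set (set (config E)) := [set A | A = set0 \/ exists F eta, A = cyl F eta].
have mcyl F eta : measurable (cyl F eta).
  have -> : cyl F eta = \bigcap_(e in [set e | e \in F]) [set w : config E | w e = eta e].
    by apply/seteqP; split=> w /= h e; exact: h.
  apply: fin_bigcap_measurable => [|e _]; first exact: finite_fset.
  by apply: sub_sigma_algebra; exists e, (eta e).
have cylT : cyl fset0 (fun=> false) = setT.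
  by apply/seteqP; split=> w //= _ e; rewrite in_fset0.
apply: (measure_unique G (fun=> setT)).
- apply/seteqP; split.
    apply: smallest_sub; first exact: smallest_sigma_algebra.
    move=> A [e [b ->]]; apply: sub_sigma_algebra; right.
    exists [fset e]%fset, (fun=> b); apply/seteqP; split=> w /=.
      by move=> web e'; rewrite inE => /eqP ->.
    by apply; rewrite inE.
  apply: smallest_sub; first exact: sigma_algebra_measurable.
  by move=> A [->|[F [eta ->]]]; [exact: measurable0|exact: mcyl].
- move=> A B [->|[F [eta ->]]]; first by rewrite set0I; left.
  case=> [->|[F' [eta' ->]]]; first by rewrite setI0; left.
  have [->|/set0P[w [wF wF']]] := eqVneq (cyl F eta `&` cyl F' eta') set0.
    by left.
  right; exists (F `|` F')%fset, w; apply/seteqP; split=> v /=.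
    by move=> [vF vF'] e; rewrite inE => /orP[eF|eF];
      [rewrite vF // wF|rewrite vF' // wF'].
  move=> h; split=> e eF; rewrite h ?inE ?eF ?orbT //;
    [exact: wF|exact: wF'].
- by move=> _; right; exists fset0, (fun=> false).
- by apply/seteqP; split=> w //= _; exists 0%N.
- move=> A [->|[F [eta ->]]]; first by rewrite !measure0.
  exact: etrans (hP F eta) (esym (hP' F eta)).
- by move=> _; apply: le_lt_trans (probability_le1 P measurableT) _; rewrite ltry.
Qed.

End bernoulli_product.

(* Meaningful for p in [0,1] only (an arbitrary probability otherwise). *)
Definition bernoulli_product (R : realType) (E : countType) (p : R) :
    probability (config E) R :=
  projT1 (cid (bernoulli_product_exists E p)).

Lemma bernoulli_productP (R : realType) (E : countType) (p : R) :
  0 <= p <= 1 -> is_bernoulli_product p (bernoulli_product E p).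
Proof. exact: (projT2 (cid (bernoulli_product_exists E p))). Qed.

Definition vertex (d : nat) := 'rV[int]_d.

(* The pair (x, i) stands for the edge {x, x + e_i}, so every nearest-neighbor
   edge of Z^d is represented exactly once (see joinsP). *)
Definition edge (d : nat) : countType := (vertex d * 'I_d)%type.

Definition tail (d : nat) (e : edge d) : vertex d := e.1.
Definition head (d : nat) (e : edge d) : vertex d := e.1 + delta_mx 0 e.2.

Definition joins (d : nat) (e : edge d) (x y : vertex d) : Prop :=
  (tail e = x /\ head e = y) \/ (tail e = y /\ head e = x).

Lemma joinsP (d : nat) (x y : vertex d) :
  (exists! e, joins e x y) <-> \sum_(i < d) `|x 0 i - y 0 i| = 1.
Proof.
have dE (i j : 'I_d) : @delta_mx int 1 d 0 i 0 j = (j == i)%:R.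
  by rewrite mxE eqxx.
have sum1 (u v : vertex d) i : u + delta_mx 0 i = v ->
    \sum_(k < d) `|u 0 k - v 0 k| = 1.
  move=> <-; rewrite (bigD1 i) //= big1 => [|k ki].
    by rewrite mxE dE eqxx opprD addNKr normrN normr1 addr0.
  by rewrite mxE dE (negbTE ki) addr0 subrr normr0.
split=> [[[z i] [/= [[<- h]|[<- h]] _]]|xy1].
- exact: sum1 h.
- by under eq_bigr do rewrite distrC; exact: sum1 h.
have [i xyi] : exists i, x 0 i != y 0 i.
  case: (pickP (fun i => x 0 i != y 0 i)) => [i ?|h]; first by exists i.
  suff : \sum_(i < d) `|x 0 i - y 0 i| = 0 by rewrite xy1.
  by apply: big1 => i _; have /negbFE/eqP -> := h i; rewrite subrr normr0.
have ge1 k : x 0 k != y 0 k -> 1 <= `|x 0 k - y 0 k|.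
  by rewrite -subr_eq0 -normr_gt0 gtz0_ge1.
have rest0 k : k != i -> x 0 k = y 0 k.
  move=> ki; apply: contraTeq isT => xyk.
  have := xy1; rewrite (bigD1 i) //= (bigD1 k) //=.
  set S := \sum_(_ < _ | _) _ => E.
  have S0 : 0 <= S by apply: sumr_ge0.
  have := lerD (ge1 i xyi) (lerD (ge1 k xyk) S0).
  by rewrite E.
have i1 : `|x 0 i - y 0 i| = 1.
  move: xy1; rewrite (bigD1 i) //= big1 ?addr0 // => k ki.
  by rewrite rest0 // subrr normr0.
have [e je] : exists e, joins e x y.
  have [yx|yx] : y = x + delta_mx 0 i \/ x = y + delta_mx 0 i.
    case: (lerP (x 0 i) (y 0 i)) => h; [left|right]; apply/rowP => k;
      rewrite mxE dE; case: (eqVneq k i) => [->|/rest0 ->]; rewrite ?addr0 //.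
      by rewrite -i1 distrC ger0_norm ?subr_ge0 // addrC subrK.
    by rewrite -i1 gtr0_norm ?subr_gt0 // addrC subrK.
  - by exists (x, i); left.
  - by exists (y, i); right.
exists e; split=> // e' je'.
have dinj (u : vertex d) (a b : 'I_d) : u + delta_mx 0 a = u + delta_mx 0 b -> a = b.
  move=> /addrI /rowP /(_ a); rewrite !dE eqxx.
  by case: eqVneq.
have dN (u v : vertex d) (a b : 'I_d) : u + delta_mx 0 a = v ->
    v + delta_mx 0 b = u -> False.
  move=> <- /rowP /(_ a); rewrite !mxE eqxx /= -addrA => /eqP.
  by rewrite -[X in _ == X]addr0 (inj_eq (addrI _)) eqxx; case: (a == b).
case: e e' je je' => [z a] [z' b]; rewrite /joins /tail /head /=.
case=> [[zx zy]|[zy zx]] [[zx' zy']|[zy' zx']]; subst z z'.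
- by congr pair; apply: (dinj x); rewrite zy zy'.
- by case: (dN _ _ _ _ zy zx').
- by case: (dN _ _ _ _ zx zy').
- by congr pair; apply: (dinj y); rewrite zx zx'.
Qed.

Definition incident (d : nat) (e : edge d) (x : vertex d) : Prop :=
  tail e = x \/ head e = x.

Definition shielded (d : nat) (w : config (edge d)) (x : vertex d) : Prop :=
  forall e : edge d, incident e x -> w e = false.

Definition infinite_shielded_path (d : nat) (w : config (edge d))
    (v : nat -> vertex d) (e : nat -> edge d) : Prop :=
  [/\ forall n, joins (e n) (v n) (v n.+1), injective v &
      forall n, shielded w (v n)].

(* The event is measurable: by Koenig's lemma it says that for some vertex x and
   all n there is a self-avoiding shielded path of length n from x. *)
Definition p_shield (R : realType) (d : nat) : R :=
  sup [set p : R | 0 <= p <= 1 /\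
    (0 < bernoulli_product (edge d) p
           [set w | exists v e, infinite_shielded_path w v e])%E].

(* Main.v *)
Require Import Defs.
From mathcomp Require Import all_boot all_order all_algebra.
From mathcomp Require Import finmap.
From mathcomp Require Import all_classical all_reals all_analysis.
From mathcomp Require Import measurable_realfun.
From mathcomp Require Import zify ring lra.
(* Imported again so that [head] is the endpoint of an edge and not the first item
   of a sequence. *)
Require Import Defs.
Import numFieldNormedType.Exports.
Import Order.TTheory GRing.Theory Num.Theory.
Set Implicit Arguments.
Unset Strict Implicit.
Unset Printing Implicit Defensive.
Local Open Scope classical_set_scope.
Local Open Scope ring_scope.

(** Write q = 1 - p and L = ln d. A vertex is shielded with probability
    q ^ (2d), which is about d ^ (- c) when p = c L / (2d), and a path has about
    d ways to continue from each vertex: the threshold is where d * d ^ (- c)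
    crosses 1, that is c = 1. The lattice is high-dimensional enough for moment
    computations to be sharp on both sides.

    No percolation for c > 1. At most 2 ^ k vertices form few adjacent pairs: a
    set S of that size is incident to at least (2d - k) |S| edges
    ([card_star_ge]). So a given self-avoiding path with r <= 2 ^ k vertices and
    k = o(d) is shielded with probability close to d ^ (- c r), and a union
    bound over the (2d) ^ r paths from x bounds the probability u(r) of a
    shielded path from x to distance r ([prob_crossing_le]). Already at r = d ^ 2
    this bound beats the volume (45 r) ^ d. Larger scales follow from
    independence: a path from x to distance 5r yields crossings of two disjoint
    boxes of radius r, around x and around a point y at distance 2r + 2
    ([crossing_split]), so that u(5r) <= (9r) ^ d u(r) ^ 2, and this recursion
    preserves the inequality (45 r) ^ d u(r) <= 1 ([prob_crossing_scales]).
    Hence u(r) tends to 0 along r = 5 ^ n d ^ 2.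

    Percolation for c < 1. Consider the paths from 0 whose steps are positive
    unit vectors, and the number Z_n of shielded ones with n steps, each one
    weighted by the inverse of its probability. Then E(Z_n ^ 2) / E(Z_n) ^ 2 is
    the mean of q ^ (- s) over two independent uniform oriented walks, where s
    is the number of edges incident to both paths. Such edges occur only when
    the difference of the walks is 0 (then 2d of them) or of the form e_i - e_j
    (then at most 2), see [card_star_shared]. The difference walk is at 0 at
    time k with probability at most the largest multinomial probability, and
    these bounds sum to O(1/d) over k >= 1 ([sum_hit_bound]). So the expected
    total overlap from any starting point is O(d ^ (c - 1) + L / d), which is
    below 1/2, and this bounds the exponential functional uniformly in n
    ([weighted_sum_le]). The second moment method gives a lower bound, uniform in
    n, on the probability of a shielded self-avoiding path with n steps from 0,
    and Koenig's lemma ([konig], [path_eventE]) turns this into an infinite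
    path. *)

(** * Independence under the Bernoulli product *)

Section Product.
Context (R : realType) (E : countType).
Implicit Types (F : {fset E}) (A B : set (config E)) (eta : E -> bool).

Definition cylinder F eta : set (config E) :=
  [set w | forall e, e \in F -> w e = eta e].

Definition all_closed F : set (config E) := cylinder F (fun=> false).

Definition determined_by F A :=
  forall w w' : config E, {in F, w =1 w'} -> A w -> A w'.

Lemma measurable_cylinder F eta : measurable (cylinder F eta).
Proof.
have -> : cylinder F eta =
    \bigcap_(e in [set e | e \in F]) [set w : config E | w e = eta e].
  by apply/seteqP; split=> w /= h e; exact: h.
apply: fin_bigcap_measurable => [|e _]; first exact: finite_fset.
by apply: sub_sigma_algebra; exists e, (eta e).
Qed.

(** The finitely many cylinders over F partition the configurations, and an
    event determined by F is a union of parts. *)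
Lemma determined_cylinders F A : determined_by F A ->
  A = \bigcup_(S in [set S : {fset E} | (S `<=` F)%fset /\ A (fun e => e \in S)])
        cylinder F (fun e => e \in S).
Proof.
move=> AF; apply/seteqP; split=> w.
  move=> Aw; pose S := [fset e in F | w e]%fset.
  have wS : {in F, w =1 (fun e => e \in S)}.
    by move=> e eF; rewrite !inE eF.
  exists S => //=; split; first by apply/fsubsetP => e; rewrite !inE => /andP[].
  exact: AF wS Aw.
by move=> [S [SF AS]] /= h; apply: AF AS => e eF; rewrite h.
Qed.

Lemma finite_subfsets F (D : set {fset E}) :
  (forall S, D S -> (S `<=` F)%fset) -> finite_set D.
Proof.
move=> DF; apply: (@sub_finite_set _ _ [set` fpowerset F]); last exact: finite_fset.
by move=> S /DF SF /=; rewrite fpowersetE.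
Qed.

Lemma measurable_determined F A : determined_by F A -> measurable A.
Proof.
move=> /determined_cylinders ->; apply: fin_bigcup_measurable => [|S _].
  by apply: (@finite_subfsets F) => S [].
exact: measurable_cylinder.
Qed.

Variables (p : R) (P : probability (config E) R).
Hypothesis PB : is_bernoulli_product p P.

Lemma prob_all_closed F : P (all_closed F) = ((1 - p) ^+ #|` F|)%:E.
Proof.
rewrite PB; congr EFin.
rewrite big_const_seq count_predT.
by elim: (size _) => //= n ->; rewrite exprS.
Qed.

(** Additivity over the partition into cylinders extends independence from the
    cylinders over F to every event determined by F. *)
Lemma independent_of_cylinders X F A : measurable X -> determined_by F A ->
  (forall eta, P (X `&` cylinder F eta) = P X * P (cylinder F eta))%E ->
  (P (X `&` A) = P X * P A)%E.
Proof.
move=> mX AF ind.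
rewrite {1 2}(determined_cylinders AF); set D := [set _ | _].
have finD : finite_set D by apply: (@finite_subfsets F) => S [].
have tD : trivIset D (fun S : {fset E} => cylinder F (fun e => e \in S)).
  move=> S S' [SF _] [S'F _] [w [/= wS wS']]; apply/fsetP => e.
  have [eF|eF] := boolP (e \in F); first by rewrite -wS // -wS'.
  rewrite (contraNF (fsubsetP SF e) eF).
  by rewrite (contraNF (fsubsetP S'F e) eF).
rewrite setI_bigcupr measure_fin_bigcup //; last 2 first.
- move=> S S' DS DS' [w [[_ wS] [_ wS']]].
  by apply: tD => //; exists w.
- by move=> S _; apply: measurableI => //; exact: measurable_cylinder.
rewrite measure_fin_bigcup //; last by move=> S _; exact: measurable_cylinder.
rewrite ge0_mule_fsumr //.
by apply: eq_fsbigr => S _; exact: ind.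
Qed.

(** The product formula gives the case of two cylinders; each of the two events
    is then replaced in turn by a union of cylinders. *)
Lemma independent_disjoint F F' A B : determined_by F A -> determined_by F' B ->
  [disjoint F & F']%fset -> (P (A `&` B) = P A * P B)%E.
Proof.
move=> AF BF' dis.
apply: (independent_of_cylinders (measurable_determined AF) BF') => eta'.
rewrite setIC muleC.
apply: (independent_of_cylinders (measurable_cylinder _ _) AF) => eta.
rewrite setIC muleC.
have F'F e : e \in F' -> (e \in F) = false.
  by move=> eF'; apply/negP => /(fdisjointP dis); rewrite eF'.
have -> : cylinder F eta `&` cylinder F' eta' =
    cylinder (F `|` F')%fset (fun e => if e \in F then eta e else eta' e).
  apply/seteqP; split=> w /=.
    by move=> [h h'] e; rewrite inE; case: ifP => eF //= eF'; [exact: h|exact: h'].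
  move=> h; split=> e eF; rewrite h ?inE ?eF ?orbT //.
  by rewrite F'F.
rewrite !PB -EFinM; congr EFin.
rewrite (perm_big (F ++ F')) /=; last first.
  apply: uniq_perm; rewrite ?fset_uniq ?cat_uniq ?fset_uniq //=.
    by rewrite andbT; apply/hasPn => e; apply: contraL => /(fdisjointP dis).
  by move=> e; rewrite inE mem_cat.
rewrite big_cat; congr (_ * _); apply: eq_big_seq => e eF; first by rewrite eF.
by rewrite F'F.
Qed.
End Product.

(** * Union bound and second moment method *)

Section SecondMoment.
Context d (T : measurableType d) (R : realType) (P : probability T R).

Lemma integral_indic_comb (I : Type) (s : seq I) (c : I -> R) (A : I -> set T) :
  (forall i, 0 <= c i) -> (forall i, measurable (A i)) ->
  (\int[P]_x (\sum_(i <- s) c i * \1_(A i) x)%:E =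
    (\sum_(i <- s) c i * fine (P (A i)))%:E)%E.
Proof.
move=> c0 mA.
under eq_integral do rewrite -sumEFin.
rewrite ge0_integral_sum //; last 2 first.
- move=> i; apply/measurable_EFinP; apply: measurable_funM => //.
- by move=> i x _; rewrite lee_fin mulr_ge0.
rewrite -sumEFin; apply: eq_bigr => i _.
under eq_integral do rewrite EFinM.
rewrite ge0_integralZl_EFin //; last by apply/measurable_EFinP.
rewrite integral_indic // setIT EFinM fineK //.
exact: fin_num_measure.
Qed.

(** Both moments are probabilities summed with nonnegative weights, so moment
    inequalities reduce to pointwise ones between sums of indicators. *)
Lemma prob_indic_comb_le (I J : Type) (s : seq I) (t : seq J) (c : I -> R) (e : J -> R)
    (A : I -> set T) (B : J -> set T) :
  (forall i, 0 <= c i) -> (forall i, measurable (A i)) ->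
  (forall j, 0 <= e j) -> (forall j, measurable (B j)) ->
  (forall x, \sum_(i <- s) c i * \1_(A i) x <= \sum_(j <- t) e j * \1_(B j) x) ->
  \sum_(i <- s) c i * fine (P (A i)) <= \sum_(j <- t) e j * fine (P (B j)).
Proof.
move=> c0 mA e0 mB h.
have mcomb (K : Type) (r : seq K) (g : K -> R) (C : K -> set T) :
    (forall k, measurable (C k)) ->
    measurable_fun setT (fun x => (\sum_(k <- r) g k * \1_(C k) x)%:E).
  move=> mC; apply/measurable_EFinP; apply: measurable_sum => k.
  exact: measurable_funM.
rewrite -lee_fin -!integral_indic_comb //; apply: ge0_le_integral => //.
- by move=> x _; rewrite lee_fin sumr_ge0 // => i _; rewrite mulr_ge0.
- exact: mcomb.
- exact: mcomb.
- by move=> x _; rewrite lee_fin.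
Qed.

(** With Z the weighted count of the events that occur, U their union and
    a = 1/K, the inequality 2 a Z <= 1_U + (a Z)^2 holds pointwise: it is a square
    on U, and Z vanishes off U. Integrating it gives 2 a <= P U + a^2 K. *)
Lemma second_moment (I : eqType) (s : seq I) (w : I -> R) (B : I -> set T) (K : R) :
  (forall i, 0 <= w i) -> (forall i, measurable (B i)) -> 0 < K ->
  \sum_(i <- s) w i * fine (P (B i)) = 1 ->
  \sum_(i <- s) \sum_(j <- s) w i * w j * fine (P (B i `&` B j)) <= K ->
  K^-1 <= fine (P (\bigcup_(i in [set` s]) B i)).
Proof.
move=> w0 mB K0 EZ EZ2; set U := \bigcup_(_ in _) _.
have mU : measurable U.
  by apply: fin_bigcup_measurable => // ; exact: finite_seq.
(* The value of a that maximizes 2 a - a ^ 2 K. *)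
pose a := K^-1.
have a0 : 0 <= a by rewrite invr_ge0 ltW.
pose e (k : option (I * I)) := oapp (fun ij => a * a * (w ij.1 * w ij.2)) 1 k.
pose C (k : option (I * I)) := oapp (fun ij => B ij.1 `&` B ij.2) U k.
have e0 k : 0 <= e k by case: k => [[i j]|] //=; rewrite !mulr_ge0.
have mC k : measurable (C k) by case: k => [[i j]|] //=; exact: measurableI.
have aw0 i : 0 <= 2 * a * w i by rewrite !mulr_ge0.
have le2 x : \sum_(i <- s) 2 * a * w i * \1_(B i) x <=
    \sum_(k <- None :: [seq Some (i, j) | i <- s, j <- s]) e k * \1_(C k) x.
  rewrite big_cons /= mul1r big_allpairs_dep /=.
  pose Z := \sum_(i <- s) w i * \1_(B i) x.
  have -> : \sum_(i <- s) 2 * a * w i * \1_(B i) x = 2 * (a * Z).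
    by rewrite /Z !mulr_sumr; apply: eq_bigr => i _; rewrite !mulrA.
  have -> : \sum_(i <- s) \sum_(j <- s) a * a * (w i * w j) * \1_(B i `&` B j) x
      = (a * Z) ^+ 2.
    rewrite exprMn /Z [X in _ = _ * X]expr2 big_distrlr /= mulr_sumr.
    apply: eq_bigr => i _; rewrite mulr_sumr; apply: eq_bigr => j _.
    by rewrite indicI /=; ring.
  have [Ux|Ux] := pselect (U x).
    have -> : \1_U x = 1 :> R by rewrite indicE mem_set.
    have := sqr_ge0 (1 - a * Z); lra.
  have -> : Z = 0.
    rewrite /Z big_seq big1 // => i si; rewrite indicE memNset ?mulr0 // => Bx.
    by apply: Ux; exists i.
  by rewrite indicE memNset // !mulr0 expr0n /= addr0.
have := prob_indic_comb_le aw0 mB e0 mC le2.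
have -> : \sum_(i <- s) 2 * a * w i * fine (P (B i)) = 2 * a.
  by under eq_bigr do rewrite -mulrA; rewrite -mulr_sumr EZ mulr1.
rewrite big_cons /= mul1r big_allpairs_dep /=.
have -> : \sum_(i <- s) \sum_(j <- s)
      a * a * (w i * w j) * fine (P (B i `&` B j)) =
    a * a * \sum_(i <- s) \sum_(j <- s) w i * w j * fine (P (B i `&` B j)).
  rewrite mulr_sumr; apply: eq_bigr => i _; rewrite mulr_sumr.
  by apply: eq_bigr => j _; rewrite !mulrA.
move: EZ2; set S := (X in X <= K) => EZ2.
have : a * a * S <= a.
  by rewrite -mulrA ler_piMr // /a mulrC ler_pdivrMr // mul1r.
set X := _ * S; move=> h1 h2; apply: le_trans (_ : a <= _); rewrite ?/a // -/a; lra.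
Qed.
End SecondMoment.

Lemma union_bound d (T : measurableType d) (R : realType) (P : probability T R)
    (I : eqType) (s : seq I) (A : I -> set T) (C : set T) (K : R) :
  measurable C -> (forall i, measurable (A i)) ->
  (C `<=` \bigcup_(i in [set` s]) A i) ->
  (forall i, i \in s -> fine (P (A i)) <= K) -> fine (P C) <= (size s)%:R * K.
Proof.
move=> mC mA CA AK.
have ge0 (X : set T) x : 0 <= \1_X x :> R by rewrite indicE.
have := @prob_indic_comb_le _ _ _ P unit I [:: tt] s (fun=> 1) (fun=> 1) (fun=> C) A.
rewrite big_seq1 mul1r => /(_ (fun=> ler01) (fun=> mC) (fun=> ler01) mA) h.
apply: le_trans (h _) _.
  move=> x; rewrite big_seq1 mul1r.
  have [Cx|Cx] := pselect (C x); last by rewrite indicE memNset //= sumr_ge0.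
  have [i si Aix] := CA x Cx.
  rewrite indicE mem_set //= (big_rem i) //= indicE mem_set // mulr1 lerDl.
  by rewrite sumr_ge0.
rewrite mulrC big_seq; under eq_bigr do rewrite mul1r.
apply: (le_trans (ler_sum _ AK)).
by rewrite -big_seq big_const_seq count_predT iter_addr addr0 mulr_natr.
Qed.

(** * Trails and edge isoperimetry in the lattice *)

Lemma card_fset_le_size (K : choiceType) (F : {fset K}) (s : seq K) :
  {subset F <= s} -> (#|` F| <= size s)%N.
Proof. by move=> Fs; apply: uniq_leq_size => //; exact: fset_uniq. Qed.

(** An explicit enumeration of all words of length n, whose sums unfold letter
    by letter. *)
Fixpoint words (T : finType) (n : nat) : seq (seq T) :=
  if n is m.+1 then [seq a :: u | a <- enum T, u <- words T m] else [:: [::]].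

Lemma mem_words (T : finType) n (u : seq T) : (u \in words T n) = (size u == n).
Proof.
elim: n u => [|n IHn] u /=; first by rewrite inE; case: u.
apply/allpairsP/eqP => [[[a v] /= [_ vn ->]]|]; first by move: vn; rewrite IHn /= => /eqP ->.
case: u => //= a u [un]; exists (a, u); split=> //=; first by rewrite mem_enum.
by rewrite IHn un.
Qed.

Lemma size_words (T : finType) n : size (words T n) = (#|T| ^ n)%N.
Proof. by elim: n => //= n IHn; rewrite size_allpairs IHn -cardE expnS. Qed.

Section Lattice.
Variable d : nat.
Implicit Types (x y z : vertex d) (e : edge d).

Notation step := ('I_d * bool)%type.

Definition unit_vec (i : 'I_d) : vertex d := delta_mx 0 i.

Lemma unit_vecE i j : unit_vec i 0 j = (j == i)%:R.
Proof. by rewrite mxE eqxx. Qed.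

(** The boolean is the orientation: [true] for a positive step. *)
Definition step_vec (s : step) : vertex d :=
  if s.2 then unit_vec s.1 else - unit_vec s.1.

Fixpoint trail x (s : seq step) : seq (vertex d) :=
  if s is a :: s' then x :: trail (x + step_vec a) s' else [:: x].

Lemma size_trail x s : size (trail x s) = (size s).+1.
Proof. by elim: s x => //= a s IHs x; rewrite IHs. Qed.

Lemma take_trail x s n : trail x (take n s) = take n.+1 (trail x s).
Proof.
elim: s x n => [|a s IHs] x [|n] //=; first by case: s {IHs}.
by rewrite IHs.
Qed.

Lemma drop_trail x s n : (n <= size s)%N ->
  trail (nth x (trail x s) n) (drop n s) = drop n (trail x s).
Proof.
elim: s x n => [|a s IHs] x [|n] //= ns.
by rewrite -IHs // (set_nth_default x) // size_trail ltnS.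
Qed.

Lemma last_trail x y s : last y (trail x s) = nth x (trail x s) (size s).
Proof. by rewrite (last_nth x) size_trail /=; case: (trail x s) (size_trail x s). Qed.

Definition star_seq x : seq (edge d) :=
  [seq (x, i) | i <- enum 'I_d] ++ [seq (x - unit_vec i, i) | i <- enum 'I_d].

Lemma mem_star_seq x e : (e \in star_seq x) = (tail e == x) || (head e == x).
Proof.
rewrite mem_cat; congr (_ || _).
  apply/mapP/eqP => [[i _ ->] //|<-]; exists e.2; rewrite ?mem_enum //.
  by case: e.
apply/mapP/eqP => [[i _ ->]|<-]; first by rewrite /head /= subrK.
exists e.2; rewrite ?mem_enum // /head addrK.
by case: e.
Qed.

Definition star (S : seq (vertex d)) : {fset edge d} :=
  [fset e in flatten [seq star_seq x | x <- S]]%fset.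

Lemma in_star S e : (e \in star S) = (tail e \in S) || (head e \in S).
Proof.
rewrite inE /=; apply/flatten_mapP/orP => [[x xS]|].
  by rewrite mem_star_seq => /orP[]/eqP ->; [left|right].
by case=> eS; [exists (tail e)|exists (head e)]; rewrite ?mem_star_seq ?eqxx ?orbT.
Qed.

Lemma tail_neq_head e : tail e != head e.
Proof.
rewrite /tail /head -subr_eq0 opprD addNKr oppr_eq0.
apply/eqP => /matrixP /(_ 0 e.2); rewrite !mxE !eqxx.
by [].
Qed.

Lemma card_star1 x : #|` star [:: x]| = (2 * d)%N.
Proof.
rewrite /star /= cats0.
have u : uniq (star_seq x).
  have i1 : injective (fun i : 'I_d => (x, i) : edge d) by move=> i j [].
  have i2 : injective (fun i : 'I_d => (x - unit_vec i, i) : edge d) by move=> i j [].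
  rewrite cat_uniq (map_inj_uniq i1) (map_inj_uniq i2) enum_uniq andbT /=.
   apply/hasPn => e /mapP[i _ ->]; apply/mapP => -[j _ [xi ij]].
  by have := tail_neq_head (x - unit_vec i, i); rewrite /head /tail /= subrK xi eqxx.
have -> : #|` [fset e in star_seq x]%fset| = size (star_seq x).
  apply/perm_size/uniq_perm => //.
  by move=> e; rewrite !inE /= mem_cat.
by rewrite size_cat !(size_map _ (enum 'I_d)) size_enum_ord mul2n addnn.
Qed.

Lemma star_eq_mem S S' : S =i S' -> star S = star S'.
Proof. by move=> SS'; apply/fsetP => e; rewrite !in_star !SS'. Qed.

Lemma star_cat S S' : star (S ++ S') = (star S `|` star S')%fset.
Proof. by apply/fsetP => e; rewrite in_fsetU !in_star !mem_cat orbACA. Qed.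

(** An edge incident to both sides of the hyperplane joins them, so it is
    parallel to the i-th axis and is determined by either endpoint. *)
Lemma card_star_cut (A B : seq (vertex d)) i (t : int) :
  {in A, forall x, x 0 i <= t} -> {in B, forall x, t < x 0 i} ->
  (#|` (star A `&` star B)%fset| <= minn (size A) (size B))%N.
Proof.
move=> At Bt.
have cut e : e \in (star A `&` star B)%fset ->
    [/\ tail e \in A, head e \in B & e.2 = i].
  have hE : (head e) 0 i = (tail e) 0 i + (i == e.2)%:R.
    by rewrite /head mxE -unit_vecE.
  rewrite in_fsetI !in_star => /andP[/orP[]eA /orP[]eB].
  - by have := At _ eA; have := Bt _ eB; lia.
  - by split=> //; move: (At _ eA) (Bt _ eB); rewrite hE; case: eqP => //; lia.
  - by have := At _ eA; have := Bt _ eB; rewrite hE; case: (i == e.2); lia.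
  - by have := At _ eA; have := Bt _ eB; lia.
rewrite leq_min; apply/andP; split.
  rewrite -(size_map (fun x => (x, i) : edge d)); apply: card_fset_le_size => e.
  by move=> /cut[eA _ ei]; apply/mapP; exists (tail e); rewrite // -ei; case: e {eA ei}.
rewrite -(size_map (fun x => (x - unit_vec i, i) : edge d)).
apply: card_fset_le_size => e.
move=> /cut[_ eB ei]; apply/mapP; exists (head e); rewrite // -ei /head addrK.
by case: e {eB ei}.
Qed.

(** Edge isoperimetry, by induction on S. Cut S by a coordinate hyperplane into
    two nonempty parts A and B; the edges counted twice are at most the size of
    the smaller part, which has at most 2 ^ (k - 1) points. The induction
    hypothesis with k - 1 for that part gains exactly this loss. *)
Lemma card_star_ge k (S : seq (vertex d)) : uniq S -> (size S <= 2 ^ k)%N ->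
  ((2 * d - k) * size S <= #|` star S|)%N.
Proof.
have [n] := ubnP (size S); elim: n k S => // n IHn k [|x S]; first by rewrite muln0.
case: S => [|y S]; first by rewrite muln1 card_star1 leq_subr.
set S' := [:: x, y & S]; rewrite ltnS => Sn uS Sk.
have xy : x != y by move: uS => /=; rewrite inE negb_or => /andP[/andP[]].
have [i xyi] : exists i, x 0 i != y 0 i.
  apply/existsP; apply: contraR xy; rewrite negb_exists => /forallP xy.
  by apply/eqP/rowP => i; apply/eqP/negbNE/xy.
pose t := Order.min (x 0 i) (y 0 i).
pose A := [seq z : vertex d <- S' | z 0 i <= t]; pose B := [seq z : vertex d <- S' | t < z 0 i].
have uA : uniq A by exact: filter_uniq.
have uB : uniq B by exact: filter_uniq.
have Bnot : B = [seq z : vertex d <- S' | predC (fun z : vertex d => z 0 i <= t) z].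
  by apply: eq_filter => z /=; rewrite ltNge.
have AB : (size A + size B = size S')%N.
  by rewrite Bnot !size_filter count_predC.
have starAB : star S' = (star A `|` star B)%fset.
  rewrite -star_cat; apply: star_eq_mem => z.
  by rewrite mem_cat !mem_filter -andb_orl [_ < _]ltNge orbN.
have [A0 B0] : (0 < size A /\ 0 < size B)%N.
  rewrite !size_filter -!has_count; split; apply/hasP.
    have [xlt|yle] := ltP (x 0 i) (y 0 i).
      by exists x; rewrite ?inE ?eqxx // /t; lia.
    by exists y; rewrite ?inE ?eqxx ?orbT // /t; lia.
  have [xlt|yle] := ltP (x 0 i) (y 0 i).
    by exists y; rewrite ?inE ?eqxx ?orbT // /t; lia.
  by exists x; rewrite ?inE ?eqxx // /t; lia.
have At : {in A, forall z : vertex d, z 0 i <= t} by move=> z; rewrite mem_filter => /andP[].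
have Bt : {in B, forall z : vertex d, t < z 0 i} by move=> z; rewrite mem_filter => /andP[].
have cI := card_star_cut At Bt.
have cU := cardfsUI (star A) (star B).
rewrite starAB.
case: k Sk => [|k] Sk; first by move: Sk; rewrite /S' /= expn0.
rewrite expnS in Sk.
have szS : (size S' = (size S).+2)%N by [].
have [k2d|k2d] := leqP (2 * d) k.
  by have -> : (2 * d - k.+1 = 0)%N by lia.
have [leAB|leBA] := leqP (size A) (size B).
  have hA := IHn k A _ uA _; have hB := IHn k.+1 B _ uB _.
  have {}hA := hA ltac:(lia) ltac:(lia).
  have {}hB := hB ltac:(lia) ltac:(rewrite expnS; lia).
  have : ((2 * d - k) * size A = (2 * d - k.+1) * size A + size A)%N by nia.
  rewrite -AB mulnDr; lia.
have hA := IHn k.+1 A _ uA _; have hB := IHn k B _ uB _.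
have {}hA := hA ltac:(lia) ltac:(rewrite expnS; lia).
have {}hB := hB ltac:(lia) ltac:(lia).
have : ((2 * d - k) * size B = (2 * d - k.+1) * size B + size B)%N by nia.
rewrite -AB mulnDr; lia.
Qed.
End Lattice.

(** * Crossing a box *)

Section Geometry.
Variable d : nat.
Implicit Types (x y z : vertex d) (e : edge d).
Notation step := ('I_d * bool)%type.

Definition ldist x y := \max_(i < d) `|(y 0 i - x 0 i)%R|%N.

Lemma ldistP x y n : (ldist x y <= n)%N <-> forall i, (`|(y 0 i - x 0 i)%R| <= n)%N.
Proof.
split=> [h i|h]; last by apply/bigmax_leqP => i _.
by apply: leq_trans h; apply: (leq_bigmax i).
Qed.

Lemma ldistxx x : ldist x x = 0%N.
Proof. by apply/eqP; rewrite -leqn0; apply/ldistP => i; rewrite subrr. Qed.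

Lemma ldist_triangle y x z : (ldist x z <= ldist x y + ldist y z)%N.
Proof.
apply/ldistP => i.
have := (ldistP x y _).1 (leqnn _) i; have := (ldistP y z _).1 (leqnn _) i; lia.
Qed.

Lemma ldist_sym x y : ldist x y = ldist y x.
Proof. by apply: eq_bigr => i _; rewrite -abszN opprB. Qed.

Lemma ldist_step x (a : step) : (ldist x (x + step_vec a)%R <= 1)%N.
Proof.
apply/ldistP => i; rewrite mxE [X in X - _]addrC addrK /step_vec.
by case: a.2; [|rewrite mxE]; rewrite unit_vecE; case: (_ == _).
Qed.

Lemma ldist_edge e : (ldist (tail e) (head e) <= 1)%N.
Proof. exact: (ldist_step e.1 (e.2, true)). Qed.

Definition box x (r : nat) : seq (vertex d) :=
  [seq x + \row_i ((f i : nat)%:Z - r%:Z) | f : {ffun 'I_d -> 'I_(2 * r).+1}].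

Lemma size_box x r : size (box x r) = ((2 * r).+1 ^ d)%N.
Proof. by rewrite size_map -cardE card_ffun !card_ord. Qed.

Lemma mem_box x r y : (y \in box x r) = (ldist x y <= r)%N.
Proof.
apply/idP/idP => [/mapP[f _ ->]|/ldistP h].
  apply/ldistP => i; rewrite !mxE; have := ltn_ord (f i).
  by move: (nat_of_ord _) (x 0 i) => b a; lia.
apply/mapP; exists [ffun i => inord `|(y 0 i - x 0 i + r%:Z)%R|%N].
  by rewrite mem_enum.
apply/rowP => i; rewrite !mxE ffunE; move: (h i).
by move: (x 0 i) (y 0 i) => a b ab; rewrite inordK; lia.
Qed.

Lemma in_trail_step (s : seq step) x n : (n < size s)%N ->
  (ldist (nth x (trail x s) n) (nth x (trail x s) n.+1) <= 1)%N.
Proof.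
elim: s x n => // a s IHs x [|n] /= ns.
  by case: s {IHs ns} => [|b s] /=; exact: ldist_step.
by rewrite !(set_nth_default (x + step_vec a)) ?size_trail //; [exact: IHs|exact: ltnW].
Qed.

Lemma ldist_trail x (s : seq step) n : (n <= size s)%N ->
  (ldist x (nth x (trail x s) n) <= n)%N.
Proof.
elim: n => [|n IHn] ns; first by case: s {ns} => [|a s] /=; rewrite ldistxx.
apply: leq_trans (ldist_triangle (nth x (trail x s) n) _ _) _.
have := in_trail_step x ns; have := IHn (ltnW ns); lia.
Qed.

(** Discrete intermediate value theorem: the distance to the starting point
    changes by at most 1 at each step. *)
Lemma first_exit r x (s : seq step) m : (m <= size s)%N ->
  (r <= ldist x (nth x (trail x s) m))%N ->
  exists n, [/\ (n <= m)%N, ldist x (nth x (trail x s) n) = r &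
    forall j, (j < n)%N -> (ldist x (nth x (trail x s) j) < r)%N].
Proof.
move=> ms rm; have ex : exists n, (r <= ldist x (nth x (trail x s) n))%N by exists m.
case: (ex_minnP ex) => n rn nmin; exists n.
have nm : (n <= m)%N by exact: nmin.
have lt j : (j < n)%N -> (ldist x (nth x (trail x s) j) < r)%N.
  by move=> jn; rewrite ltnNge; apply: contraL jn => /nmin; rewrite -leqNgt.
split=> //; apply/eqP; rewrite eqn_leq rn andbT.
case: n nm lt {rn nmin} => [|n] nm lt.
  by case: s {ms rm nm ex lt} => [|a s] /=; rewrite ldistxx.
apply: leq_trans (ldist_triangle (nth x (trail x s) n) _ _) _.
have := lt n (leqnn _); have := @in_trail_step s x n (leq_trans nm ms); lia.
Qed.

Lemma all_closed_starP S (w : config (edge d)) :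
  all_closed (star S) w <-> forall x, x \in S -> shielded w x.
Proof.
split=> [h x xS e ex|h e].
  by apply: h; rewrite in_star; case: ex => ->; rewrite xS ?orbT.
by rewrite in_star => /orP[] /h; apply; [left|right].
Qed.

Lemma all_closed_star_sub (S S' : seq (vertex d)) w : {subset S' <= S} ->
  all_closed (star S) w -> all_closed (star S') w.
Proof. by move=> SS' /all_closed_starP h; apply/all_closed_starP => x /SS' /h. Qed.

(** Asking the path to stay in the box makes the event depend on finitely many
    edges only. *)
Definition crossing r x : set (config (edge d)) :=
  [set w | exists s : seq step, [/\ uniq (trail x s),
     {subset trail x s <= box x r},
     (r <= ldist x (last x (trail x s)))%N & all_closed (star (trail x s)) w]].

Lemma determined_crossing r x : determined_by (star (box x r)) (crossing r x).
Proof.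
move=> w w' ww' [s [us sb rs sw]]; exists s; split=> //.
move=> e es; rewrite -ww' ?sw //; move: es; rewrite !in_star.
by case/orP => /sb ->; rewrite ?orbT.
Qed.

(** Cutting the path at its first visit to distance r. *)
Lemma crossing_of_trail r x (s : seq step) m w : uniq (trail x s) ->
  all_closed (star (trail x s)) w -> (m <= size s)%N ->
  (r <= ldist x (nth x (trail x s) m))%N -> crossing r x w.
Proof.
move=> us sw ms /(first_exit ms)[n [nm rn lt]].
have ns := leq_trans nm ms.
have lastE : last x (trail x (take n s)) = nth x (trail x s) n.
  by rewrite last_trail take_trail size_takel // nth_take.
rewrite take_trail in lastE; exists (take n s); rewrite take_trail.
have szt : size (take n.+1 (trail x s)) = n.+1.
  by rewrite size_takel // size_trail ltnS.
split.
- exact: take_uniq.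
- move=> y /(nthP x)[j]; rewrite szt ltnS => jn <-; rewrite nth_take // mem_box.
  by move: jn; rewrite leq_eqVlt => /orP[/eqP -> |/lt/ltnW//]; rewrite rn.
- by rewrite lastE rn.
- by apply: all_closed_star_sub sw => y /mem_take.
Qed.

(** Distance r cannot be reached in fewer than r steps. *)
Lemma crossing_length r x w : crossing r x w ->
  exists2 s : seq step, size s = r /\ uniq (trail x s) & all_closed (star (trail x s)) w.
Proof.
move=> [s [us _ rs sw]]; have rsize : (r <= size s)%N.
  by apply: leq_trans rs _; rewrite last_trail ldist_trail.
exists (take r s); rewrite ?size_takel ?take_trail ?take_uniq //.
by apply: all_closed_star_sub sw => y /mem_take.
Qed.

(** The two boxes of radius r around x and y have no edge in common because y is
    at distance 2r + 2, see [disjoint_star_box]. The part of the path after y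
    still goes from distance 2r + 2 to 5r from x, hence farther than r from y. *)
Lemma crossing_split r x w : (0 < r)%N -> crossing (5 * r) x w ->
  exists2 y, ldist x y = (2 * r).+2 & crossing r x w /\ crossing r y w.
Proof.
move=> r0 [s [us _]]; rewrite last_trail => rs sw.
have [|n [ns ny _]] := @first_exit (2 * r).+2 x s (size s) (leqnn _); first by lia.
exists (nth x (trail x s) n) => //; split.
  by apply: (crossing_of_trail us sw (leqnn _)); lia.
have drop_last :
    nth (nth x (trail x s) n) (trail (nth x (trail x s) n) (drop n s)) (size s - n) =
    nth x (trail x s) (size s).
  rewrite drop_trail // nth_drop subnKC //.
  by apply: set_nth_default; rewrite size_trail.
apply: (@crossing_of_trail _ _ (drop n s) (size s - n)).
- by rewrite drop_trail // drop_uniq.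
- by rewrite drop_trail //; apply: all_closed_star_sub sw => y /mem_drop.
- by rewrite size_drop.
- rewrite drop_last.
  by have := ldist_triangle (nth x (trail x s) n) x (nth x (trail x s) (size s)); lia.
Qed.

Lemma disjoint_star_box r x y : ldist x y = (2 * r).+2 ->
  [disjoint star (box x r) & star (box y r)]%fset.
Proof.
move=> xy; apply/fdisjointP => e; rewrite !in_star !mem_box => ex; apply/negP => ey.
have te := ldist_edge e; have he : (ldist (head e) (tail e) <= 1)%N by rewrite ldist_sym.
have {}xy a b : (ldist x a <= r)%N -> (ldist y b <= r)%N -> (2 <= ldist a b)%N.
  move=> xa yb; have := ldist_triangle a x y; have := ldist_triangle b a y.
  by rewrite [ldist b y]ldist_sym; lia.
case/orP: ex => ex; case/orP: ey => ey; have := xy _ _ ex ey; rewrite ?ldistxx; lia.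
Qed.
End Geometry.

(** * Compactness: from finite to infinite shielded paths *)

(** Koenig's lemma. A prefix is kept when it has good extensions of every
    length; among finitely many one-letter extensions of such a prefix, one is
    again such. *)
Lemma konig (T : finType) (good : seq T -> Prop) :
  (forall u t, good (u ++ t) -> good u) ->
  (forall n, exists2 u, size u = n & good u) ->
  exists f : nat -> T, forall n, good (mkseq f n).
Proof.
move=> gpre gall.
(* Extendability to every length is what survives from one prefix to the next. *)
pose ext u := forall n, exists2 t, size t = n & good (u ++ t).
have ext0 : ext [::] by [].
have extS u : exists a, ext u -> ext (rcons u a).
  have [a0 _] : exists a0 : T, True.
    by have [[|a t] //] := gall 1; exists a.
  have [eu|] := pselect (ext u); last by exists a0.
  apply: contrapT => /forallNP no.
  have bad a : exists n, ~ exists2 t, size t = n & good (rcons u a ++ t).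
    by apply/existsNP => ea; apply: (no a).
  have [N badN] := choice bad.
  have [[//|a t] /= [szt]] := eu (\max_a N a).+1.
  rewrite -cat_rcons => g; apply: (badN a); exists (take (N a) t).
    by rewrite size_takel // szt; exact: leq_bigmax.
  by apply: (gpre _ (drop (N a) t)); rewrite -catA cat_take_drop.
have [F FP] := choice extS.
pose U n := iter n (fun u => rcons u (F u)) [::].
have extU n : ext (U n) by elim: n => //= n; exact: FP.
exists (fun n => F (U n)) => n.
suff -> : mkseq (fun n => F (U n)) n = U n.
  by have [t /size0nil -> ] := extU n 0%N; rewrite cats0.
elim: n => // n IHn.
by rewrite /mkseq -addn1 iotaD map_cat /= -/(mkseq _ n) IHn add0n cats1 addn1.
Qed.

Section Paths.
Variable d : nat.
Implicit Types (x y z : vertex d) (e : edge d).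
Notation step := ('I_d * bool)%type.

Lemma joins_step x y : (exists e, joins e x y) <-> exists a : step, y = x + step_vec a.
Proof.
split=> [[e [[<- <-]|[<- <-]]]|[[i [] ->]]].
- by exists (e.2, true).
- by exists (e.2, false); rewrite /step_vec /head /= addrK.
- by exists (x, i); left.
- by exists (x - unit_vec i, i); right; rewrite /step_vec /= /head subrK.
Qed.

Lemma trail_mkseq (v : nat -> vertex d) (f : nat -> step) n :
  (forall n, v n.+1 = v n + step_vec (f n)) ->
  trail (v 0%N) (mkseq f n) = mkseq v n.+1.
Proof.
move=> vf; elim: n v f vf => [|n IHn] v f vf //.
have mkseqS (T : Type) (g : nat -> T) m : mkseq g m.+1 = g 0%N :: mkseq (g \o succn) m.
  by rewrite /mkseq /= (iotaDl 1 0) -map_comp.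
by rewrite !mkseqS /= -vf (IHn (v \o succn) (f \o succn)) ?mkseqS // => m; exact: vf.
Qed.

(** The name stands for self-avoiding walk. *)
Definition saw n x : set (config (edge d)) :=
  [set w | exists s : seq step, [/\ size s = n, uniq (trail x s) &
     all_closed (star (trail x s)) w]].

Lemma determined_saw n x : determined_by (star (box x n)) (saw n x).
Proof.
have sub (s : seq step) : size s = n -> {subset trail x s <= box x n}.
  move=> sn y /(nthP x)[j]; rewrite size_trail ltnS sn => jn <-; rewrite mem_box.
  by apply: (leq_trans (ldist_trail x _) jn); rewrite sn.
move=> w w' ww' [s [sn us sw]]; exists s; split=> //.
move=> e es; rewrite -ww' ?sw //; move: es; rewrite !in_star.
by case/orP => /(sub _ sn) ->; rewrite ?orbT.
Qed.

Definition path_event : set (config (edge d)) :=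
  [set w | exists v (es : nat -> edge d), infinite_shielded_path w v es].

(** This makes the event of the theorem measurable, and reduces the existence of
    an infinite path to that of finite ones. *)
Lemma path_eventE : path_event = \bigcup_x \bigcap_n saw n x.
Proof.
apply/seteqP; split=> w.
  move=> [v [e [je vi sv]]]; exists (v 0%N) => // n _.
  have /choice[f vf] m : exists a, v m.+1 = v m + step_vec a.
    by apply/joins_step; exists (e m).
  exists (mkseq f n); rewrite size_mkseq (trail_mkseq _ vf); split=> //.
    by rewrite mkseq_uniq.
  by apply/all_closed_starP => x /mapP[m _ ->].
move=> [x _ wx].
have [u t|n|f fP] := @konig _ (fun s : seq step =>
    uniq (trail x s) /\ all_closed (star (trail x s)) w).
- have -> : trail x u = take (size u).+1 (trail x (u ++ t)).
    by rewrite -take_trail take_size_cat.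
  move=> [us sw]; split; first exact: take_uniq.
  by apply: all_closed_star_sub sw => y /mem_take.
- by have [s [sn us sw]] := wx n I; exists s.
pose v n := iteri n (fun m y => y + step_vec (f m)) x.
have vf n : v n.+1 = v n + step_vec (f n) by [].
have tv n : trail x (mkseq f n) = mkseq v n.+1 by exact: (trail_mkseq n vf).
have /choice[e je] n : exists e, joins e (v n) (v n.+1).
  by apply/joins_step; exists (f n); rewrite vf.
exists v, e; split=> //.
  move=> m n vmn.
  have [] := fP (maxn m n); rewrite tv => /(uniqP x) u _.
  move: (u m n); rewrite !inE !size_mkseq !nth_mkseq ?ltnS ?leq_maxl ?leq_maxr //.
  by apply.
move=> n; have [_] := fP n; rewrite tv => /all_closed_starP; apply.
by apply/mapP; exists n; rewrite // mem_iota /= add0n.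
Qed.

Lemma measurable_path_event : measurable path_event.
Proof.
rewrite path_eventE; apply: countable_bigcupT_measurable => [|x]; first exact: countableP.
apply: bigcap_measurable => // n _; exact: measurable_determined (@determined_saw n x).
Qed.

(** An injective sequence leaves every box, which is finite. *)
Lemma path_crossing w v (es : nat -> edge d) r :
  infinite_shielded_path w v es -> crossing r (v 0%N) w.
Proof.
move=> [je vi sv].
have /choice[f vf] m : exists a, v m.+1 = v m + step_vec a.
  by apply/joins_step; exists (es m).
have [m mr] : exists m, (r < ldist (v 0%N) (v m))%N.
  apply: contrapT => /forallNP no.
  have um : uniq (mkseq v (size (box (v 0%N) r)).+1) by rewrite mkseq_uniq.
  have sub : {subset mkseq v (size (box (v 0%N) r)).+1 <= box (v 0%N) r}.
    by move=> y /mapP[m _ ->]; rewrite mem_box leqNgt; apply/negP/no.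
  by have := uniq_leq_size um sub; rewrite size_mkseq ltnn.
apply: (@crossing_of_trail _ r (v 0%N) (mkseq f m) m); rewrite ?size_mkseq //.
- by rewrite (trail_mkseq _ vf) mkseq_uniq.
- by rewrite (trail_mkseq _ vf); apply/all_closed_starP => x /mapP[k _ ->].
- by rewrite (trail_mkseq _ vf) nth_mkseq // ltnW.
Qed.
End Paths.

(** * No percolation above the threshold *)

Section Subcritical.
Variables (R : realType) (d : nat) (p : R).
Hypothesis p01 : 0 <= p <= 1.
Let P := bernoulli_product (edge d) p.
Let PB : is_bernoulli_product p P := @bernoulli_productP R (edge d) p p01.
Let q0 : 0 <= 1 - p. Proof. by case/andP: p01; rewrite subr_ge0. Qed.
Let q1 : 1 - p <= 1. Proof. by case/andP: p01 => ? _; rewrite gerBl. Qed.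

(** Since q <= 1, it suffices to bound the number of incident edges from below. *)
Lemma prob_star_le k (S : seq (vertex d)) : uniq S -> (size S <= 2 ^ k)%N ->
  fine (P (all_closed (star S))) <= (1 - p) ^+ ((2 * d - k) * size S).
Proof.
move=> uS Sk; rewrite (prob_all_closed PB) /=.
by apply: ler_wiXn2l; rewrite ?q0 ?q1 //; exact: card_star_ge.
Qed.

(** A path that reaches distance r has a prefix with r steps, hence with r + 1
    vertices, and there are (2d) ^ r words of r steps. *)
Lemma prob_crossing_le k r (x : vertex d) : (r < 2 ^ k)%N ->
  fine (P (crossing r x)) <= (2 * d)%:R ^+ r * (1 - p) ^+ ((2 * d - k) * r.+1).
Proof.
move=> rk.
have -> : (2 * d)%:R ^+ r = (size (words ('I_d * bool)%type r))%:R :> R.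
  by rewrite size_words card_prod card_ord card_bool mulnC natrX.
pose A s := if uniq (trail x s) then all_closed (star (trail x s)) else set0.
apply: (@union_bound _ _ _ _ _ _ A).
- exact: measurable_determined (@determined_crossing d r x).
- by move=> s; rewrite /A; case: ifP => // _; exact: measurable_cylinder.
- move=> w /crossing_length[s [sr us] sw]; exists s; first by rewrite /= mem_words sr.
  by rewrite /A us.
- move=> s; rewrite mem_words /A => /eqP sr; case: ifP => us; last first.
    by rewrite measure0 exprn_ge0.
  by have := prob_star_le us (k := k); rewrite size_trail sr; apply.
Qed.

(** There are at most (4r + 5) ^ d points y at distance 2r + 2 from x, and
    (4r + 5) <= 9r. *)
Lemma prob_crossing_step (u : R) r (x : vertex d) : (0 < r)%N ->
  (forall y : vertex d, fine (P (crossing r y)) <= u) ->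
  fine (P (crossing (5 * r) x)) <= ((9 * r) ^ d)%:R * (u * u).
Proof.
move=> r0 hu.
have mc y r' : measurable (crossing r' y) := measurable_determined (@determined_crossing d r' y).
have u0 : 0 <= u by apply: le_trans (hu x); rewrite fine_ge0.
pose s := [seq y <- box x (2 * r).+2 | ldist x y == (2 * r).+2].
apply: (@le_trans _ _ ((size s)%:R * (u * u))).
  apply: (@union_bound _ _ _ _ _ _ (fun y => crossing r x `&` crossing r y)) => //.
  - by move=> y; exact: measurableI.
  - move=> w /(crossing_split r0)[y xy [wx wy]]; exists y => //=.
    by rewrite mem_filter mem_box xy eqxx leqnn.
  - move=> y; rewrite mem_filter => /andP[/eqP xy _].
    have ind := independent_disjoint PB
      (@determined_crossing d r x) (@determined_crossing d r y).
    by rewrite ind ?disjoint_star_box // fineM ?fin_num_measure // ler_pM ?fine_ge0.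
apply: ler_wpM2r; first exact: mulr_ge0.
rewrite ler_nat; apply: (leq_trans (size_subseq (filter_subseq _ _))).
rewrite size_box; case: (posnP d) => [->|d0]; first by rewrite !expn0.
by rewrite leq_exp2r //; lia.
Qed.

(** The constant 45 is the fixed point of the recursion: 5 * 45 * 9 = 45 ^ 2. *)
Lemma prob_crossing_scales r n : (0 < r)%N ->
  (forall x : vertex d, ((45 * r) ^ d)%:R * fine (P (crossing r x)) <= 1) ->
  forall x : vertex d, ((45 * (5 ^ n * r)) ^ d)%:R * fine (P (crossing (5 ^ n * r) x)) <= 1.
Proof.
move=> r0 hr; elim: n => [|n IHn] x; first by rewrite mul1n.
rewrite expnS -mulnA; set r' := (5 ^ n * r)%N in IHn *.
have r'0 : (0 < r')%N by rewrite muln_gt0 expn_gt0.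
set M : R := ((45 * r') ^ d)%:R in IHn *.
have M0 : 0 < M by rewrite ltr0n expn_gt0 muln_gt0 r'0.
have h : fine (P (crossing (5 * r') x)) <= ((9 * r') ^ d)%:R * (M^-1 * M^-1).
  by apply: prob_crossing_step => // y; rewrite -[leRHS]mulr1 ler_pdivlMl.
apply: (le_trans (ler_wpM2l _ h)) => //.
have -> : ((45 * (5 * r')) ^ d)%:R * (((9 * r') ^ d)%:R * (M^-1 * M^-1)) = 1 :> R.
  rewrite mulrA -natrM -expnMn.
  have -> : (45 * (5 * r') * (9 * r') = (45 * r') * (45 * r'))%N by lia.
  rewrite expnMn natrM -/M mulrACA divff ?mulr1 //; exact: lt0r_neq0.
by [].
Qed.

(** The crossing probabilities tend to 0 along the scales 5 ^ n r, so that
    almost surely no vertex starts an infinite path. *)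
Lemma no_infinite_path r : (0 < d)%N -> (0 < r)%N ->
  (forall x : vertex d, ((45 * r) ^ d)%:R * fine (P (crossing r x)) <= 1) ->
  P (@path_event d) = 0%E.
Proof.
move=> d0 r0 hr.
have mc y r' : measurable (crossing r' y) := measurable_determined (@determined_crossing d r' y).
pose N (x : vertex d) := \bigcap_n crossing (5 ^ n * r) x.
have mN x : measurable (N x) by apply: bigcap_measurable.
have N0 x : P (N x) = 0%E.
  have Nfin : P (N x) \is a fin_num by exact: fin_num_measure.
  apply/eqP; rewrite -(fineK Nfin) eqe eq_le fine_ge0 // andbT.
  rewrite leNgt; apply/negP => pos.
  pose n := Num.truncn (fine (P (N x)))^-1.
  have ltn : (fine (P (N x)))^-1 < n.+1%:R by exact: truncnS_gt.
  have h := prob_crossing_scales n.+1 r0 hr x.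
  have big : (n.+1 <= (45 * (5 ^ n.+1 * r)) ^ d)%N.
    have h5 : (n.+1 < 5 ^ n.+1)%N by exact: ltn_expl.
    apply: (@leq_trans (45 * (5 ^ n.+1 * r))); first by nia.
    by rewrite -[X in (X <= _)%N]expn1 leq_pexp2l // muln_gt0 muln_gt0 expn_gt0.
  have le : fine (P (N x)) <= fine (P (crossing (5 ^ n.+1 * r) x)).
    rewrite fine_le ?fin_num_measure //; apply: le_measure; rewrite ?inE //.
    by move=> w /(_ n.+1 I).
  have : 1 < n.+1%:R * fine (P (N x)) by rewrite -ltr_pdivrMr // div1r.
  apply/negP; rewrite -leNgt; apply: le_trans h.
  by apply: ler_pM; rewrite ?ler_nat // ltW.
apply/negligibleP; first exact: measurable_path_event.
pose N' k := oapp N set0 (@choice.unpickle (vertex d) k).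
apply: (@negligibleS _ _ _ P (\bigcup_k N' k)).
  move=> w [v [es wv]]; exists (choice.pickle (v 0%N)); rewrite // /N' choice.pickleK.
  by move=> n _; exact: path_crossing wv.
apply: negligible_bigcup => k; rewrite /N'; case: choice.unpickle => [x|] /=.
  by apply/negligibleP; [exact: mN|exact: N0].
exact: negligible_set0.
Qed.

(** A criterion at one scale: the bound of [prob_crossing_le] has to beat the
    volume factor of the recursion. *)
Lemma subcritical k r : (0 < d)%N -> (0 < r)%N -> (r < 2 ^ k)%N ->
  ((45 * r) ^ d)%:R * ((2 * d)%:R ^+ r * (1 - p) ^+ ((2 * d - k) * r.+1)) <= 1 ->
  P (@path_event d) = 0%E.
Proof.
move=> d0 r0 rk h; apply: (no_infinite_path d0 r0) => x.
apply: le_trans h; apply: ler_wpM2l => //; exact: prob_crossing_le.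
Qed.
End Subcritical.

(** * Return probabilities of the oriented walk *)

Section Multinomial.
Variables (R : realType) (d : nat).
Hypothesis d0 : (0 < d)%N.
Implicit Types (x y z : vertex d) (f g : vertex d -> R).

Let dR0 : 0 < d%:R :> R. Proof. by rewrite ltr0n. Qed.
Let dRn0 : d%:R != 0 :> R. Proof. exact: lt0r_neq0. Qed.

(** The Markov operator of the walk whose increments are uniform among the s i. *)
Definition shift_avg (s : 'I_d -> vertex d) f x : R :=
  d%:R^-1 * \sum_i f (x + s i).

Definition at_origin x : R := (x == 0)%:R.

(** The probability that the oriented walk, started at 0, is at y at time k. *)
Definition hit_prob k : vertex d -> R :=
  iter k (shift_avg (fun i => - unit_vec i)) at_origin.
Arguments hit_prob : simpl never.

Lemma hit_probS k y : hit_prob k.+1 y = d%:R^-1 * \sum_i hit_prob k (y - unit_vec i).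
Proof. by []. Qed.

Lemma sub_unit_vecE y i j : (y - unit_vec i) 0 j = y 0 j - (j == i)%:R.
Proof. by rewrite mxE [X in _ + X]mxE unit_vecE. Qed.

Lemma hit_prob_ge0 k y : 0 <= hit_prob k y.
Proof.
elim: k y => [|k IHk] y; first by rewrite /hit_prob /= /at_origin ler0n.
by rewrite hit_probS mulr_ge0 ?invr_ge0 ?ler0n // sumr_ge0.
Qed.

(** Among the walks of length k that end at y, a proportion y_i / k ends with a
    step in direction i; this is the recursion of multinomial coefficients. *)
Lemma hit_prob_coord k y i :
  (y 0 i)%:~R * hit_prob k y = k%:R / d%:R * hit_prob k.-1 (y - unit_vec i).
Proof.
elim: k y i => [|k IHk] y i.
  by rewrite !mul0r /hit_prob /= /at_origin; case: eqP => [->|]; rewrite ?mxE ?mul0r ?mulr0.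
rewrite hit_probS mulrCA mulr_sumr.
have E j : (y 0 i)%:~R * hit_prob k (y - unit_vec j) =
    k%:R / d%:R * hit_prob k.-1 (y - unit_vec i - unit_vec j) +
    (i == j)%:R * hit_prob k (y - unit_vec j).
  have := IHk (y - unit_vec j) i; rewrite sub_unit_vecE addrAC => <-; rewrite rmorphB /=.
  by case: (i == j) => /=; ring.
under eq_bigr do rewrite E.
rewrite big_split /= -mulr_sumr.
have -> : \sum_j (i == j)%:R * hit_prob k (y - unit_vec j) = hit_prob k (y - unit_vec i).
  rewrite (bigD1 i) //= eqxx mul1r big1 ?addr0 // => j ji.
  by rewrite eq_sym (negbTE ji) mul0r.
case: k {IHk E} => [|k] /=; first by rewrite !mul0r add0r div1r.
rewrite hit_probS; set S := \sum_(_ < _) _; rewrite -[k.+2]addn1 natrD; field.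
by [].
Qed.

Lemma hit_prob_support k y : hit_prob k y != 0 -> \sum_i y 0 i = k%:Z.
Proof.
elim: k y => [|k IHk] y.
  rewrite /hit_prob /= /at_origin; case: (eqVneq y 0) => [-> _|_]; last by rewrite eqxx.
  by rewrite big1 // => i _; rewrite mxE.
rewrite hit_probS => h.
have [i hi] : exists i, hit_prob k (y - unit_vec i) != 0.
  apply/existsP; apply: contraR h; rewrite negb_exists => /forallP h.
  by rewrite big1 ?mulr0 // => i _; apply/eqP; have := h i; rewrite negbK.
have := IHk _ hi.
under eq_bigr do rewrite sub_unit_vecE.
rewrite sumrB; have -> : \sum_(j < d) (j == i)%:R = 1 :> int.
  by rewrite (bigD1 i) //= eqxx big1 ?addr0 // => j /negbTE ->.
by move=> /eqP; rewrite subr_eq => /eqP ->; rewrite -[k.+1]addn1.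
Qed.

(** The largest multinomial probability: at each time the recursion
    [hit_prob_coord] is used in a direction whose coordinate is largest, hence at
    least 1 + floor (k' / d) by the pigeonhole principle. *)
Fixpoint hit_bound k : R :=
  if k is k'.+1 then hit_bound k' * (k%:R / (d * (k' %/ d).+1)%:R) else 1.

Lemma hit_bound_gt0 k : 0 < hit_bound k.
Proof.
elim: k => [|k IHk] //=.
by rewrite mulr_gt0 // divr_gt0 // ltr0n // muln_gt0 d0.
Qed.

Lemma hit_prob_le k y : hit_prob k y <= hit_bound k.
Proof.
elim: k y => [|k IHk] y; first by rewrite /hit_prob /= /at_origin lern1 leq_b1.
have [->|h] := eqVneq (hit_prob k.+1 y) 0; first by rewrite ltW ?hit_bound_gt0.
set m := (k %/ d).+1.
(* The coordinates of y sum to k + 1 > d * (k / d). *)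
have [i yi] : exists i, m%:Z <= y 0 i.
  apply: contrapT => /forallNP no.
  have := hit_prob_support h; apply/eqP; rewrite lt_eqF //.
  apply: (@le_lt_trans _ _ (\sum_(i < d) (m%:Z - 1))).
    by apply: ler_sum => i _; have /negP := no i; rewrite -ltNge; lia.
  rewrite sumr_const card_ord /m.
  have -> : (k %/ d).+1%:Z - 1 = (k %/ d)%N%:Z by lia.
  rewrite -mulr_natr natz -PoszM ltz_nat ltnS; exact: leq_divM.
have mR : m%:R * hit_prob k.+1 y <= (y 0 i)%:~R * hit_prob k.+1 y.
  by apply: ler_wpM2r; rewrite ?hit_prob_ge0 // pmulrn ler_int.
rewrite hit_prob_coord /= in mR.
have m0 : 0 < m%:R :> R by rewrite ltr0n.
rewrite -/m /=.
have -> : hit_bound k * (k.+1%:R / (d * m)%:R) = m%:R^-1 * (k.+1%:R / d%:R * hit_bound k).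
  by rewrite natrM; field; rewrite dRn0 lt0r_neq0.
rewrite ler_pdivlMl //; apply: (le_trans mR); apply: ler_wpM2l => //.
Qed.

Lemma hit_boundS_le k : hit_bound k.+1 <= hit_bound k.
Proof.
rewrite /= ler_piMr ?(ltW (hit_bound_gt0 k)) // ler_pdivrMr; last first.
  by rewrite ltr0n muln_gt0 d0.
by rewrite mul1r ler_nat mulnC ltn_ceil.
Qed.

Lemma hit_bound_le j k : (j <= k)%N -> hit_bound k <= hit_bound j.
Proof.
move=> /subnK <-; elim: (k - j)%N => //= n IHn.
exact: le_trans (hit_boundS_le _) IHn.
Qed.

Lemma hit_bound_small k : (k <= d)%N -> hit_bound k = (k`!)%:R / d%:R ^+ k.
Proof.
elim: k => [|k IHk] kd; first by rewrite /= divr1.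
rewrite /= IHk ?(ltnW kd) // divn_small // muln1 factS natrM exprS invfM.
by field; rewrite dRn0 expf_neq0.
Qed.

(** In the block of d times that starts at d (m + 1), each of the first four
    factors of [hit_bound] is at most (2m + 3) / (2m + 4), since 4 <= d / 2, and the
    others are at most 1. As ((2m + 3) / (2m + 4)) ^ 2 <= (2m + 3) / (2m + 5), the
    bounds telescope from block to block, starting with
    hit_bound d <= hit_bound 4 = 24 / d ^ 4. *)
Lemma hit_bound_block m : (8 <= d)%N ->
  hit_bound (d * m.+1) <= 24 / d%:R ^+ 4 * (9 / (2 * m%:R + 3) ^+ 2).
Proof.
move=> d8; elim: m => [|m IHm].
  have -> : 9 / (2 * 0%:R + 3) ^+ 2 = 1 :> R by rewrite mulr0 add0r; field.
  rewrite mulr1 -[24]/(4`!%:R) -hit_bound_small; last by lia.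
  by apply: hit_bound_le; lia.
pose t : R := (2 * m%:R + 3) / (2 * m%:R + 4).
have mR : 0 <= m%:R :> R by [].
have t0 : 0 <= t by rewrite divr_ge0 //; lra.
have stepk j : (j < 4)%N ->
    hit_bound (d * m.+1 + j).+1 <= hit_bound (d * m.+1 + j) * t.
  move=> j4; rewrite /= ler_wpM2l ?(ltW (hit_bound_gt0 _)) //.
  have -> : ((d * m.+1 + j) %/ d = m.+1)%N.
    by rewrite mulnC divnMDl // divn_small ?addn0 //; lia.
  rewrite /t ler_pdivrMr; last by rewrite ltr0n muln_gt0 d0.
  rewrite mulrAC ler_pdivlMr; last by lra.
  have -> : 2 * m%:R + 4 = (2 * m + 4)%N%:R :> R by rewrite natrD natrM.
  have -> : 2 * m%:R + 3 = (2 * m + 3)%N%:R :> R by rewrite natrD natrM.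
  rewrite -!natrM ler_nat; nia.
have four : hit_bound (d * m.+1 + 4) <= hit_bound (d * m.+1) * t ^+ 4.
  have s0 := stepk 0%N isT; have s1 := stepk 1%N isT.
  have s2 := stepk 2%N isT; have s3 := stepk 3%N isT.
  rewrite !addnS !addn0 in s0 s1 s2 s3 *.
  apply: (le_trans s3); rewrite exprSr mulrA ler_wpM2r //.
  apply: (le_trans s2); rewrite exprSr mulrA ler_wpM2r //.
  apply: (le_trans s1); rewrite exprSr mulrA ler_wpM2r //.
apply: (@le_trans _ _ (hit_bound (d * m.+1 + 4))); first by apply: hit_bound_le; lia.
apply: (le_trans four).
apply: (le_trans (ler_wpM2r (exprn_ge0 4 t0) IHm)).
rewrite -[leLHS]mulrA ler_wpM2l ?divr_ge0 ?exprn_ge0 //.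
rewrite mulrAC -[leLHS]mulrA ler_pM2l //.
have a0 : 0 < 2 * m%:R + 3 :> R by lra.
have b0 : 0 < 2 * m%:R + 4 :> R by lra.
have -> : 2 * m.+1%:R + 3 = 2 * m%:R + 5 :> R by rewrite -[m.+1]addn1 natrD; ring.
have c0 : 0 < 2 * m%:R + 5 :> R by lra.
set a := 2 * m%:R + 3 in a0 t0 *; set b := 2 * m%:R + 4 in b0 t0 *.
set c := 2 * m%:R + 5 in c0 t0 *.
have tb : t ^+ 2 <= a / c.
  rewrite /t -/a -/b expr_div_n ler_pdivrMr ?exprn_gt0 // mulrAC ler_pdivlMr //.
  rewrite expr2 -!mulrA ler_wpM2l ?(ltW a0) // /a /b /c; nra.
have : t ^+ 4 <= (a / c) ^+ 2.
  by rewrite -[4%N]/(2 * 2)%N exprM lerXn2r // ?nnegrE ?exprn_ge0 ?divr_ge0 ?ltW.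
move=> h; rewrite ler_pdivrMr ?exprn_gt0 //; apply: (le_trans h).
by rewrite expr_div_n mulrC.
Qed.

(** Times below d contribute at most d * hit_bound 3 = 6 / d ^ 2. Each later
    block contributes at most d times its first term, and the resulting series
    of 1 / (2m + 3) ^ 2 is compared with a telescoping one. *)
Lemma sum_hit_bound_tail n : (8 <= d)%N ->
  \sum_(3 <= k < n) hit_bound k <= 20 / d%:R ^+ 2.
Proof.
move=> d8.
have d8R : 8 <= d%:R :> R by rewrite ler_nat.
have ge0 a b : 0 <= \sum_(a <= k < b) hit_bound k.
  by rewrite sumr_ge0 // => k _; exact: ltW (hit_bound_gt0 k).
have blocks m : \sum_(3 <= k < d * m.+1) hit_bound k <=
    6 / d%:R ^+ 2 + 108 / d%:R ^+ 3 * (1 - 1 / (2 * m%:R + 1)).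
  elim: m => [|m IHm].
    rewrite muln1 mulr0 add0r divr1 subrr mulr0 addr0.
    rewrite (@le_trans _ _ (\sum_(3 <= k < d) (6 / d%:R ^+ 3))) //.
      rewrite big_nat [X in _ <= X]big_nat; apply: ler_sum => k /andP[k3 _].
      by apply: (le_trans (hit_bound_le k3)); rewrite hit_bound_small //; lia.
    rewrite sumr_const_nat -(mulr_natr (6 / _)) mulrAC -[leLHS]mulrA ler_pM2l //.
    rewrite ler_pdivrMr ?exprn_gt0 //.
    rewrite [d%:R ^+ 3]exprSr mulrA mulVf ?mul1r ?ler_nat ?leq_subr ?expf_neq0 //.
  have mR : 0 <= m%:R :> R by [].
  rewrite (big_cat_nat (n := d * m.+1)) /=; [|lia|lia].
  have h : \sum_(d * m.+1 <= k < d * m.+2) hit_bound k <=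
      d%:R * (24 / d%:R ^+ 4 * (9 / (2 * m%:R + 3) ^+ 2)).
    rewrite (@le_trans _ _ (\sum_(d * m.+1 <= k < d * m.+2)
      (24 / d%:R ^+ 4 * (9 / (2 * m%:R + 3) ^+ 2)))) //.
      rewrite big_nat [X in _ <= X]big_nat; apply: ler_sum => k /andP[k3 _].
      by apply: (le_trans (hit_bound_le k3)); exact: hit_bound_block.
    rewrite sumr_const_nat mulnS addnK; set X := (_ * (9 / _)); by rewrite -(mulr_natl X).
  apply: (le_trans (lerD IHm h)).
  rewrite -addrA lerD2l.
  have -> : d%:R * (24 / d%:R ^+ 4 * (9 / (2 * m%:R + 3) ^+ 2)) =
      108 / d%:R ^+ 3 * (2 / (2 * m%:R + 3) ^+ 2) :> R.
    have : 2 * m%:R + 3 != 0 :> R by apply: lt0r_neq0; lra.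
    by move=> ?; field; apply/andP.
  rewrite -mulrDr ler_wpM2l ?divr_ge0 ?exprn_ge0 //.
  rewrite -addrA lerD2l.
  have -> : 2 * m.+1%:R + 1 = 2 * m%:R + 3 :> R by rewrite -[m.+1]addn1 natrD; ring.
  have a0 : 0 < 2 * m%:R + 1 :> R by lra.
  have c0 : 0 < 2 * m%:R + 3 :> R by lra.
  rewrite -subr_ge0.
  have -> : - (1 / (2 * m%:R + 3)) - (- (1 / (2 * m%:R + 1)) + 2 / (2 * m%:R + 3) ^+ 2) =
     4 / ((2 * m%:R + 3) ^+ 2 * (2 * m%:R + 1)) :> R.
    by field; rewrite !lt0r_neq0.
  by rewrite divr_ge0 // mulr_ge0 ?exprn_ge0 ?ltW.
have n3 : (n <= d * n.+1)%N by nia.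
apply: (@le_trans _ _ (\sum_(3 <= k < d * n.+1) hit_bound k)).
  have [n3'|n3'] := leqP 3 n; last by rewrite big_geq 1?ltnW.
  by rewrite [X in _ <= X](big_cat_nat (n := n)) //= lerDl.
apply: (le_trans (blocks n)).
have -> : 20 / d%:R ^+ 2 = 6 / d%:R ^+ 2 + 14 / d%:R ^+ 2 :> R.
  by rewrite -mulrDl; congr (_ / _); ring.
rewrite lerD2l; apply: (@le_trans _ _ (108 / d%:R ^+ 3)).
  rewrite ler_piMr ?divr_ge0 ?exprn_ge0 // gerBl divr_ge0 // addr_ge0 // mulr_ge0 //.
rewrite [d%:R ^+ 3]exprS invfM mulrA ler_pM2r ?invr_gt0 ?exprn_gt0 //.
by rewrite ler_pdivrMr //; lra.
Qed.

Lemma sum_hit_bound n : (8 <= d)%N -> \sum_(1 <= k < n) hit_bound k <= 4 / d%:R.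
Proof.
move=> d8; have d8R : 8 <= d%:R :> R by rewrite ler_nat.
apply: (@le_trans _ _ (\sum_(1 <= k < n.+3) hit_bound k)).
  have [n1|n1] := leqP 1 n.
    rewrite [X in _ <= X](big_cat_nat (n := n)) //= ?lerDl; last by lia.
    by rewrite sumr_ge0 // => k _; exact: ltW (hit_bound_gt0 k).
  by rewrite big_geq ?sumr_ge0 // => [k _|]; [exact: ltW (hit_bound_gt0 k)|lia].
rewrite big_ltn // big_ltn //.
have h := sum_hit_bound_tail n.+3 d8.
rewrite !hit_bound_small; [|lia|lia].
have -> : 4 / d%:R = 1%:R / d%:R ^+ 1 + (2%:R / d%:R ^+ 2 + (3 * d%:R - 2) / d%:R ^+ 2) :> R.
  by rewrite expr1; field.
rewrite !lerD2l; apply: (le_trans h); rewrite ler_pM2r ?invr_gt0 ?exprn_gt0 //; lra.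
Qed.
End Multinomial.

(** * Two oriented walks: total overlap *)

Section DifferenceWalk.
Variables (R : realType) (d : nat).
Hypothesis d0 : (0 < d)%N.
Implicit Types (x y z : vertex d) (f g : vertex d -> R).

Let dR0 : 0 < d%:R :> R. Proof. by rewrite ltr0n. Qed.
Let dRn0 : d%:R != 0 :> R. Proof. exact: lt0r_neq0. Qed.

Section ShiftAvg.
Variable s : 'I_d -> vertex d.

Lemma shift_avg_mono f g : (forall x, f x <= g x) ->
  forall x, shift_avg s f x <= shift_avg s g x.
Proof. by move=> fg x; rewrite ler_pM2l ?invr_gt0 // ler_sum. Qed.

Lemma shift_avgD f g x :
  shift_avg s (fun x => f x + g x) x = shift_avg s f x + shift_avg s g x.
Proof. by rewrite /shift_avg big_split mulrDr. Qed.

Lemma shift_avgZ (c : R) f x : shift_avg s (fun x => c * f x) x = c * shift_avg s f x.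
Proof. by rewrite /shift_avg -mulr_sumr mulrCA. Qed.

Lemma shift_avg_cst (c : R) x : shift_avg s (fun=> c) x = c.
Proof. by rewrite /shift_avg sumr_const card_ord -(mulr_natl c) mulKf. Qed.
End ShiftAvg.

Lemma shift_avgC (s t : 'I_d -> vertex d) f :
  shift_avg s (shift_avg t f) = shift_avg t (shift_avg s f).
Proof.
apply/funext => x; rewrite /shift_avg; congr (_ * _).
under eq_bigr do rewrite mulr_sumr.
under [RHS]eq_bigr do rewrite mulr_sumr.
rewrite exchange_big /=; apply: eq_bigr => i _; apply: eq_bigr => j _.
by rewrite addrAC.
Qed.

(** The Markov operator of the difference of two independent oriented walks. *)
Definition diff_step f : vertex d -> R :=
  shift_avg (@unit_vec d) (shift_avg (fun i => - unit_vec i) f).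

Lemma diff_stepE f x :
  diff_step f x = (d%:R ^+ 2)^-1 * \sum_i \sum_j f (x + unit_vec i - unit_vec j).
Proof. by rewrite /diff_step /shift_avg -mulr_sumr mulrA -invfM. Qed.

Lemma diff_step_mono f g : (forall x, f x <= g x) -> forall x, diff_step f x <= diff_step g x.
Proof. by move=> fg; do 2 apply: shift_avg_mono. Qed.

Lemma diff_stepD f g x : diff_step (fun x => f x + g x) x = diff_step f x + diff_step g x.
Proof.
rewrite /diff_step -shift_avgD; congr shift_avg.
by apply/funext => y; rewrite shift_avgD.
Qed.

Lemma diff_stepZ c f x : diff_step (fun x => c * f x) x = c * diff_step f x.
Proof.
rewrite /diff_step -shift_avgZ; congr shift_avg.
by apply/funext => y; rewrite shift_avgZ.
Qed.

Lemma diff_step_cst (c : R) x : diff_step (fun=> c) x = c.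
Proof.
rewrite /diff_step; have -> : shift_avg (fun i => - @unit_vec d i) (fun=> c) = fun=> c.
  by apply/funext => y; rewrite shift_avg_cst.
exact: shift_avg_cst.
Qed.

Lemma iter_diff_step_mono k f g : (forall x, f x <= g x) ->
  forall x, iter k diff_step f x <= iter k diff_step g x.
Proof. by move=> fg; elim: k => //= k IHk; exact: diff_step_mono. Qed.

Lemma iter_diff_stepD k f g x :
  iter k diff_step (fun x => f x + g x) x = iter k diff_step f x + iter k diff_step g x.
Proof.
elim: k x => //= k IHk x; rewrite -diff_stepD; congr diff_step.
by apply/funext => y; rewrite IHk.
Qed.

Lemma iter_diff_stepZ k c f x :
  iter k diff_step (fun x => c * f x) x = c * iter k diff_step f x.
Proof.
elim: k x => //= k IHk x; rewrite -diff_stepZ; congr diff_step.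
by apply/funext => y; rewrite IHk.
Qed.

Lemma iter_diff_step_cst k (c : R) x : iter k diff_step (fun=> c) x = c.
Proof.
elim: k x => //= k IHk x; rewrite -[RHS](diff_step_cst c x); congr diff_step.
by apply/funext => y; rewrite IHk.
Qed.

(** The increments of the two walks commute, so the walks can be run one after the
    other; averaging over one of them does not increase a uniform bound that
    holds for the other. *)
Lemma iter_diff_step_origin k x : iter k diff_step (@at_origin R d) x <= hit_bound R d k.
Proof.
have -> : iter k diff_step (@at_origin R d) =
    iter k (shift_avg (@unit_vec d)) (@hit_prob R d k).
  have comm j (s t : 'I_d -> vertex d) g :
      shift_avg t (iter j (shift_avg s) g) = iter j (shift_avg s) (shift_avg t g).
    by elim: j => //= j <-; rewrite shift_avgC.
  by elim: k => //= k ->; rewrite /diff_step comm.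
elim: {1}k x => [|j IHj] x /=; first exact: hit_prob_le.
by rewrite -[leRHS](shift_avg_cst (@unit_vec d) _ x); exact: shift_avg_mono.
Qed.

(** The positions e_i - e_j of the difference walk: those from which it can
    be at 0 one step later. *)
Definition unit_diff x : bool := [exists i, exists j, x == unit_vec i - unit_vec j].

(** From a position e_i - e_j the difference walk reaches 0 in one step with
    probability at least 1 / d ^ 2. *)
Lemma unit_diff_le x : (unit_diff x)%:R <= d%:R ^+ 2 * diff_step (@at_origin R d) x.
Proof.
have nn (i j : 'I_d) : 0 <= at_origin R (x + unit_vec i - unit_vec j).
  by rewrite /at_origin ler0n.
rewrite diff_stepE mulVKf ?expf_neq0 //.
case: (boolP (unit_diff x)) => [/existsP[i /existsP[j /eqP xij]]|_]; last first.
  by rewrite sumr_ge0 // => i _; rewrite sumr_ge0.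
have -> : true%:R = at_origin R (x + unit_vec j - unit_vec i) :> R.
  by rewrite /at_origin xij subrK subrr eqxx.
rewrite (bigD1 j) //= (bigD1 i) //= -addrA lerDl addr_ge0 ?sumr_ge0 // => k _.
by rewrite sumr_ge0.
Qed.

Lemma iter_diff_step_unit_diff k x :
  iter k diff_step (fun x => (unit_diff x)%:R) x <= d%:R ^+ 2 * hit_bound R d k.+1.
Proof.
apply: (le_trans (iter_diff_step_mono k unit_diff_le x)).
rewrite iter_diff_stepZ -iterSr ler_pM2l ?exprn_gt0 //.
exact: iter_diff_step_origin.
Qed.

Lemma iter_diff_step_unit_diff1 k x : iter k diff_step (fun x => (unit_diff x)%:R) x <= 1.
Proof.
rewrite -[leRHS](iter_diff_step_cst k 1 x).
by apply: iter_diff_step_mono => y; rewrite lern1 leq_b1.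
Qed.

Lemma sum_iter_origin n x : (8 <= d)%N ->
  \sum_(1 <= k < n) iter k diff_step (@at_origin R d) x <= 4 / d%:R.
Proof.
move=> d8; apply: le_trans (sum_hit_bound R d0 n d8).
by apply: ler_sum => k _; exact: iter_diff_step_origin.
Qed.

(** The first term is at most 1, and by [unit_diff_le] the others are dominated
    by d ^ 2 hit_bound k with k >= 3. *)
Lemma sum_iter_unit_diff n x : (8 <= d)%N ->
  \sum_(1 <= k < n) iter k diff_step (fun x => (unit_diff x)%:R) x <= 21.
Proof.
move=> d8.
have ge0 k : 0 <= iter k diff_step (fun x => (unit_diff x)%:R) x.
  rewrite -[leLHS](iter_diff_step_cst k 0 x).
  by apply: iter_diff_step_mono => y; rewrite ler0n.
apply: (@le_trans _ _ (\sum_(1 <= k < n.+2) iter k diff_step (fun x => (unit_diff x)%:R) x)).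
  have [n1|n1] := leqP 1 n; last by rewrite big_geq ?sumr_ge0 //; lia.
  by rewrite [X in _ <= X](big_cat_nat (n := n)) //= ?lerDl ?sumr_ge0 //; lia.
rewrite big_ltn //.
have h : \sum_(2 <= k < n.+2) iter k diff_step (fun x => (unit_diff x)%:R) x <= 20.
  apply: (@le_trans _ _ (\sum_(2 <= k < n.+2) d%:R ^+ 2 * hit_bound R d k.+1)).
    by apply: ler_sum => k _; exact: iter_diff_step_unit_diff.
  rewrite -mulr_sumr -ler_pdivlMl ?exprn_gt0 // mulrC.
  by have := sum_hit_bound_tail R d0 n.+3 d8; rewrite big_add1.
have := iter_diff_step_unit_diff1 1 x; lra.
Qed.

Section Weight.
Variable V : vertex d -> R.
Hypothesis V0 : forall x, 0 <= V x.

(** The expectation, for the difference walk D started at x, of the product of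
    1 + V (D_k) over k = 1, ..., n. *)
Fixpoint weighted_sum n : vertex d -> R :=
  if n is n'.+1 then diff_step (fun x => (1 + V x) * weighted_sum n' x) else fun=> 1.

(** A Khas'minskii type bound. The function h_n = 1 + 2 sum_(1 <= k <= n) T^k V,
    where T is [diff_step], takes values in [1, 2], and T ((1 + V) h_n) is at most
    T h_n + 2 T V = h_(n + 1); so it dominates the weighted sum inductively. *)
Lemma weighted_sum_le n x :
  (forall m y, \sum_(1 <= k < m.+1) iter k diff_step V y <= 1 / 2) -> weighted_sum n x <= 2.
Proof.
move=> Vle; pose h m y := 1 + 2 * \sum_(1 <= k < m.+1) iter k diff_step V y.
have h2 m y : h m y <= 2 by have := Vle m y; rewrite /h; lra.
suff : forall y, weighted_sum n y <= h n y by move=> /(_ x) hx; exact: le_trans hx (h2 _ _).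
elim: n {x} => [|n IHn] y /=; first by rewrite /h big_geq // mulr0 addr0.
apply: (@le_trans _ _ (diff_step (fun x => h n x + 2 * V x) y)).
  apply: diff_step_mono => x; rewrite mulrDl mul1r lerD ?IHn // mulrC ler_wpM2r //.
  by rewrite (le_trans (IHn x)).
rewrite diff_stepD diff_stepZ /h diff_stepD diff_step_cst diff_stepZ.
rewrite -addrA -mulrDr lerD2l ler_pM2l // [X in _ <= X]big_ltn //= addrC lerD2l.
rewrite [X in _ <= X]big_add1 /=.
suff -> : diff_step (fun x => \sum_(1 <= k < n.+1) iter k diff_step V x) y =
  \sum_(1 <= k < n.+1) diff_step (iter k diff_step V) y by [].
elim: (n.+1) => [|m IHm].
  by under eq_fun do rewrite big_geq //; rewrite diff_step_cst big_geq.
case: m IHm => [|m] IHm.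
  by under eq_fun do rewrite big_geq //; rewrite diff_step_cst big_geq.
under eq_fun do rewrite big_nat_recr //=.
by rewrite diff_stepD big_nat_recr //= IHm.
Qed.

Fixpoint pair_weight x (u v : seq 'I_d) : R :=
  if (u, v) is (a :: u', b :: v') then
    let x' := x + unit_vec a - unit_vec b in (1 + V x') * pair_weight x' u' v'
  else 1.

Lemma sum_pair_weight n x :
  \sum_(u <- words 'I_d n) \sum_(v <- words 'I_d n) pair_weight x u v =
  (d%:R ^+ n) ^+ 2 * weighted_sum n x.
Proof.
elim: n x => [|n IHn] x /=; first by rewrite !big_seq1 /= expr0 expr1n mul1r.
rewrite diff_stepE [d%:R ^+ n.+1]exprS exprMn mulrA [_ * _^-1]mulrAC divff ?expf_neq0 // mul1r.
rewrite mulr_sumr big_allpairs_dep big_enum /=; apply: eq_bigr => a _.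
under eq_bigr do rewrite big_allpairs_dep /= big_enum /=.
rewrite exchange_big mulr_sumr /=; apply: eq_bigr => b _.
by rewrite mulrCA -IHn mulr_sumr; apply: eq_bigr => u _; rewrite mulr_sumr.
Qed.
End Weight.

End DifferenceWalk.

(** * Edges shared by two oriented paths *)

Section OrientedPaths.
Variable d : nat.
Implicit Types (x y z : vertex d) (e : edge d).

Definition level x : int := \sum_i x 0 i.

Lemma level_add x i : level (x + unit_vec i) = level x + 1.
Proof.
rewrite /level; under eq_bigr do rewrite mxE unit_vecE.
rewrite big_split /=; congr (_ + _); rewrite (bigD1 i) //= eqxx big1 ?addr0 // => j.
by move=> /negbTE ->.
Qed.

Definition oriented_trail x (u : seq 'I_d) : seq (vertex d) :=
  trail x [seq (i, true) | i <- u].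

Lemma oriented_trail_cons x i u :
  oriented_trail x (i :: u) = x :: oriented_trail (x + unit_vec i) u.
Proof. by []. Qed.

Lemma oriented_trail_level x u y : y \in oriented_trail x u -> y != x -> level x + 1 <= level y.
Proof.
elim: u x => [|i u IHu] x; first by rewrite inE => /eqP ->; rewrite eqxx.
rewrite oriented_trail_cons inE => /orP[/eqP ->|]; first by rewrite eqxx.
have [-> _ _|ne yu _] := eqVneq y (x + unit_vec i); first by rewrite level_add.
by have := IHu _ yu ne; rewrite level_add; lia.
Qed.

Lemma uniq_oriented_trail x u : uniq (oriented_trail x u).
Proof.
elim: u x => [|i u IHu] x //; rewrite oriented_trail_cons /= IHu andbT.
apply/negP => xu; have := level_add x i; have [xi|ne] := eqVneq x (x + unit_vec i).
  by rewrite -xi; lia.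
by have := oriented_trail_level xu ne; lia.
Qed.

(** A bound on the number of edges incident to the current vertices of two
    oriented paths with difference D, or to the current vertex of one and the next
    vertex of the other. *)
Definition shared_edges (D : vertex d) : nat := ((2 * d) * (D == 0%R) + 2 * unit_diff D)%N.

(** The endpoints of an edge lie on different levels, so two distinct vertices of
    the same level have no common edge. *)
Lemma card_star_same_level x y : level x = level y ->
  (#|` (star [:: x] `&` star [:: y])%fset| <= (2 * d) * (x - y == 0)%R)%N.
Proof.
move=> lxy; rewrite subr_eq0; case: eqVneq => [->|ne].
  by rewrite fsetIid card_star1 muln1.
rewrite muln0 leqn0 cardfs_eq0; apply/eqP/fsetP => e; rewrite in_fset0 in_fsetI !in_star !inE.
apply/negP => /andP[/orP[]/eqP ex /orP[]/eqP ey].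
- by move: ne; rewrite -ex ey eqxx.
- by have := level_add (tail e) e.2; rewrite -[_ + _]/(head e) ex ey lxy; lia.
- by have := level_add (tail e) e.2; rewrite -[_ + _]/(head e) ex ey lxy; lia.
- by move: ne; rewrite -ex ey eqxx.
Qed.

(** Edges join consecutive levels, so a common edge goes from x to the first
    vertex of the second path: there is at most one. *)
Lemma card_star_next_level x y i u : level x = level y ->
  (#|` (star [:: x] `&` star (oriented_trail (y + unit_vec i)%R u))%fset| <=
    unit_diff (x - y)%R)%N.
Proof.
move=> lxy.
have main e : e \in (star [:: x] `&` star (oriented_trail (y + unit_vec i)%R u))%fset ->
    tail e = x /\ x + unit_vec e.2 = y + unit_vec i.
  have le := level_add (tail e) e.2; rewrite -[_ + _]/(head e) in le.
  rewrite in_fsetI !in_star !inE.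
  have up z : z \in oriented_trail (y + unit_vec i) u -> z != y + unit_vec i ->
      level y + 2 <= level z.
    by move=> zu ne; have := oriented_trail_level zu ne; rewrite level_add; lia.
  have lyi := level_add y i.
  have up1 z : z \in oriented_trail (y + unit_vec i) u -> level y + 1 <= level z.
    by move=> zu; case: (eqVneq z (y + unit_vec i)) => [->|/(up _ zu)]; lia.
  case/andP => /orP[]/eqP ex /orP[] eu.
  - by have := up1 _ eu; rewrite ex; lia.
  - split=> //; rewrite -ex -[_ + _]/(head e); apply/eqP; apply: contraT => /(up _ eu).
    by rewrite ex in le; lia.
  - by have := up1 _ eu; rewrite ex in le; lia.
  - by have := up1 _ eu; rewrite ex; lia.
case: (boolP (unit_diff (x - y))) => [_|nud]; last first.
  rewrite leqn0 cardfs_eq0; apply/eqP/fsetP => e; rewrite in_fset0; apply/negP.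
  move=> /main[_ xe]; case/negP: nud; apply/existsP; exists i; apply/existsP; exists e.2.
  by rewrite subr_eq addrAC eq_sym subr_eq addrC -xe eqxx.
case: (fset_0Vmem (star [:: x] `&` star (oriented_trail (y + unit_vec i)%R u))%fset)
    => [->|[e0 /main[e0x e0i]]].
  by rewrite cardfs0.
(* A second common edge would have the same endpoints as the first one. *)
apply: (@leq_trans (size [:: e0])) => //; apply: card_fset_le_size => e /main[ex ei].
rewrite inE; case: e e0 ex ei e0x e0i => [z j] [z0 j0] /= -> ei -> e0i.
rewrite xpair_eqE eqxx /=; move: e0i; rewrite -ei => /addrI /matrixP /(_ 0 j0).
by rewrite !unit_vecE eqxx; case: eqVneq => // ->.
Qed.

Fixpoint shared_along (D : vertex d) (u v : seq 'I_d) : nat :=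
  if (u, v) is (a :: u', b :: v') then
    let D' := (D + unit_vec a - unit_vec b)%R in (shared_edges D' + shared_along D' u' v')%N
  else 0%N.

Lemma star_cons x S : star (x :: S) = (star [:: x] `|` star S)%fset.
Proof. exact: (star_cat [:: x] S). Qed.

(** Vertices of the two paths share an edge only if their levels differ by at
    most 1. The three cases are [card_star_same_level] and
    [card_star_next_level] used in both orders. *)
Lemma card_star_shared x y u v : level x = level y -> size u = size v ->
  (#|` (star (oriented_trail x u) `&` star (oriented_trail y v))%fset| <=
    shared_edges (x - y)%R + shared_along (x - y)%R u v)%N.
Proof.
elim: u v x y => [|a u IHu] [|b v] x y //= lxy; rewrite ?addn0 => suv.
  by apply: leq_trans (card_star_same_level lxy) (leq_addr _ _).
rewrite !oriented_trail_cons !(star_cons _ (oriented_trail _ _)).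
set A := star [:: x]; set A' := star (oriented_trail _ _).
set B := star [:: y]; set B' := star (oriented_trail _ _).
have sub : ((A `|` A') `&` (B `|` B') `<=`
    ((A `&` B) `|` (A `&` B')) `|` ((B `&` A') `|` (A' `&` B')))%fset.
  apply/fsubsetP => e; rewrite !(in_fsetI, in_fsetU).
  by case: (e \in A); case: (e \in B); case: (e \in A'); case: (e \in B').
apply: (leq_trans (fsubset_leq_card sub)).
have cU (F G : {fset edge d}) : (#|` (F `|` G)%fset| <= #|` F| + #|` G|)%N.
  by rewrite -cardfsUI leq_addr.
apply: (leq_trans (cU _ _)).
have hAB := card_star_same_level lxy.
have hAB' := @card_star_next_level x y b v lxy.
have hBA' := @card_star_next_level y x a u (esym lxy).
have unit_diffC : unit_diff (y - x) = unit_diff (x - y).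
  apply/existsP/existsP => -[i /existsP[j /eqP ij]]; exists j; apply/existsP; exists i;
    by rewrite -opprB ij opprB.
have hA'B' : (#|` (A' `&` B')%fset| <= _)%N :=
  IHu v (x + unit_vec a) (y + unit_vec b) ltac:(by rewrite !level_add lxy) ltac:(by case: suv).
have E : x + unit_vec a - (y + unit_vec b) = x - y + unit_vec a - unit_vec b.
  by rewrite opprD addrA [x + _ - y]addrAC.
rewrite E in hA'B'.
rewrite unit_diffC in hBA'.
have := cU (A `&` B)%fset (A `&` B')%fset; have := cU (B `&` A')%fset (A' `&` B')%fset.
rewrite /shared_edges; move: hAB hAB' hBA' hA'B'; rewrite /shared_edges -/A -/B -/A' -/B'.
set n1 := (_ * (_ == _))%N; set n2 := nat_of_bool (unit_diff _).
lia.
Qed.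
End OrientedPaths.

(** * Percolation below the threshold *)

Section Supercritical.
Variables (R : realType) (d : nat) (p : R).
Hypothesis p01 : 0 <= p < 1.
Hypothesis d8 : (8 <= d)%N.
Let p01' : 0 <= p <= 1. Proof. by case/andP: p01 => -> /ltW. Qed.
Let P := bernoulli_product (edge d) p.
Let PB : is_bernoulli_product p P := @bernoulli_productP R (edge d) p p01'.
Let q0 : 0 < 1 - p. Proof. by case/andP: p01 => _; rewrite subr_gt0. Qed.
Let q1 : 1 - p <= 1. Proof. by case/andP: p01 => ? _; rewrite gerBl. Qed.
Let d0 : (0 < d)%N. Proof. exact: leq_trans d8. Qed.
Implicit Types (x y : vertex d) (u v : seq 'I_d).

Let r := (1 - p)^-1.
Let r1 : 1 <= r. Proof. by rewrite /r invf_ge1. Qed.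

Definition shielded_oriented u : set (config (edge d)) :=
  all_closed (star (oriented_trail 0 u)).

Let prob u : R := fine (P (shielded_oriented u)).

Lemma prob_shielded_oriented u : prob u = (1 - p) ^+ #|` star (oriented_trail 0 u)|.
Proof. by rewrite /prob (prob_all_closed PB). Qed.

Lemma prob_shielded_oriented_gt0 u : 0 < prob u.
Proof. by rewrite prob_shielded_oriented exprn_gt0. Qed.

(** With this weight V, a product of factors 1 + V is r raised to the sum of the
    [shared_edges] along the walk, where r = 1 / q. *)
Definition overlap_weight x : R := r ^+ shared_edges x - 1.

Lemma overlap_weight_ge0 x : 0 <= overlap_weight x.
Proof. by rewrite subr_ge0 exprn_ege1. Qed.

Lemma shared_along_weight x u v : r ^+ shared_along x u v = pair_weight overlap_weight x u v.
Proof.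
elim: u v x => [|a u IHu] [|b v] x //=; rewrite ?expr0 //.
by rewrite exprD IHu /overlap_weight [1 + _]addrC subrK.
Qed.

(** The probability of the intersection exceeds the product of the
    probabilities by a factor r ^ s, where s is the number of common edges. *)
Lemma prob_shielded_pair_le u v : size u = size v ->
  fine (P (shielded_oriented u `&` shielded_oriented v)) <=
  prob u * prob v * (r ^+ shared_edges (0 : vertex d) * pair_weight overlap_weight 0 u v).
Proof.
move=> suv.
set F := star (oriented_trail 0 u); set G := star (oriented_trail 0 v).
have -> : shielded_oriented u `&` shielded_oriented v = all_closed (F `|` G)%fset.
  apply/seteqP; split=> w.
    by move=> [wF wG] e; rewrite in_fsetU => /orP[/wF|/wG].
  by move=> w0; split=> e eF; apply: w0; rewrite in_fsetU eF ?orbT.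
rewrite (prob_all_closed PB) /= !prob_shielded_oriented -/F -/G.
rewrite -exprD -cardfsUI exprD -mulrA ler_peMr ?exprn_ge0 ?(ltW q0) //.
rewrite -shared_along_weight -exprD.
have := @card_star_shared d 0 0 u v erefl suv; rewrite subrr -/F -/G => FG.
apply: (@le_trans _ _ ((1 - p) ^+ #|` (F `&` G)%fset| * r ^+ #|` (F `&` G)%fset|)).
  by rewrite /r exprVn divff // expf_neq0 // lt0r_neq0.
by rewrite ler_pM2l ?exprn_gt0 //; apply: ler_weXn2l.
Qed.

Lemma overlap_weight_le x : overlap_weight x <=
  (r ^+ (2 * d).+2 - 1) * at_origin R x + (r ^+ 2 - 1) * (unit_diff x)%:R.
Proof.
rewrite /overlap_weight /shared_edges /at_origin.
have r2 : 1 <= r ^+ 2 by exact: exprn_ege1.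
case: (x == 0); last first.
  rewrite muln0 mulr0 add0r; case: (unit_diff x); rewrite ?muln1 ?mulr1 //.
  by rewrite muln0 mulr0 subrr.
rewrite muln1 mulr1.
apply: (@le_trans _ _ (r ^+ (2 * d).+2 - 1)).
  by rewrite lerD2r; apply: ler_weXn2l => //; case: (unit_diff x); lia.
by rewrite lerDl mulr_ge0 // subr_ge0.
Qed.

Hypothesis small : (r ^+ (2 * d).+2 - 1) * (4 / d%:R) + (r ^+ 2 - 1) * 21 <= 1 / 2.

Lemma sum_overlap_weight m x :
  \sum_(1 <= k < m.+1) iter k (@diff_step R d) overlap_weight x <= 1 / 2.
Proof.
apply: le_trans small.
apply: (@le_trans _ _ (\sum_(1 <= k < m.+1)
   ((r ^+ (2 * d).+2 - 1) * iter k (@diff_step R d) (@at_origin R d) x +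
    (r ^+ 2 - 1) * iter k (@diff_step R d) (fun x => (unit_diff x)%:R) x))).
  apply: ler_sum => k _; rewrite -!iter_diff_stepZ -iter_diff_stepD.
  exact: (iter_diff_step_mono d0 k overlap_weight_le).
rewrite big_split /= -!mulr_sumr lerD // ler_wpM2l ?subr_ge0 ?exprn_ege1 //.
  exact: sum_iter_origin.
exact: sum_iter_unit_diff.
Qed.

(** Each path is weighted by the inverse of its probability, so that Z has mean 1
    and its second moment is a mean over pairs of paths. *)
Lemma prob_saw_ge n :
  (2 * r ^+ shared_edges (0 : vertex d))^-1 <= fine (P (saw n (0 : vertex d))).
Proof.
have mB u : measurable (shielded_oriented u) by exact: measurable_cylinder.
set K := 2 * _.
have K0 : 0 < K by rewrite mulr_gt0 // exprn_gt0 // invr_gt0.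
pose w u := (d%:R ^+ n * prob u)^-1.
have w0 u : 0 <= w u by rewrite invr_ge0 mulr_ge0 ?exprn_ge0 // ltW ?prob_shielded_oriented_gt0.
have dn0 : d%:R ^+ n != 0 :> R by rewrite expf_neq0 // pnatr_eq0 -lt0n.
have pn0 u : prob u != 0 by rewrite lt0r_neq0 ?prob_shielded_oriented_gt0.
have EZ : \sum_(u <- words 'I_d n) w u * prob u = 1.
  under eq_bigr => u _ do rewrite /w invfM -mulrA mulVf // mulr1.
  rewrite big_const_seq count_predT iter_addr addr0 size_words card_ord.
  by rewrite -(mulr_natr (_ ^-1)) natrX mulVf.
have EZ2 : \sum_(u <- words 'I_d n) \sum_(v <- words 'I_d n)
    w u * w v * fine (P (shielded_oriented u `&` shielded_oriented v)) <= K.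
  pose W := r ^+ shared_edges (0 : vertex d).
  apply: (@le_trans _ _ (\sum_(u <- words 'I_d n) \sum_(v <- words 'I_d n)
     (((d%:R ^+ n) ^+ 2)^-1 * W * pair_weight overlap_weight 0 u v))).
    rewrite big_seq [X in _ <= X]big_seq; apply: ler_sum => u; rewrite mem_words => /eqP su.
    rewrite big_seq [X in _ <= X]big_seq; apply: ler_sum => v; rewrite mem_words => /eqP sv.
    have h := @prob_shielded_pair_le u v (etrans su (esym sv)).
    apply: (le_trans (ler_wpM2l _ h)); first by rewrite mulr_ge0.
    rewrite -/W /w; rewrite le_eqVlt; apply/orP; left; apply/eqP; field.
    by rewrite !pn0 dn0.
  under eq_bigr do rewrite -mulr_sumr.
  rewrite -mulr_sumr (sum_pair_weight d0).
  have -> : ((d%:R ^+ n) ^+ 2)^-1 * W * ((d%:R ^+ n) ^+ 2 * weighted_sum overlap_weight n 0) =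
      weighted_sum overlap_weight n 0 * W by field.
  rewrite ler_wpM2r ?exprn_ge0 ?(le_trans ler01) //.
  exact: (weighted_sum_le d0 overlap_weight_ge0 _ _ sum_overlap_weight).
have h := second_moment w0 mB K0 EZ EZ2.
have msaw : measurable (saw n (0 : vertex d)) := measurable_determined (@determined_saw d n 0).
have mU : measurable (\bigcup_(u in [set` words 'I_d n]) shielded_oriented u).
  by apply: fin_bigcup_measurable => //; exact: finite_seq.
apply: (le_trans h); rewrite fine_le ?fin_num_measure //.
apply: le_measure; rewrite ?inE // => w' [u /=]; rewrite mem_words => /eqP un wu.
exists [seq (i, true) | i <- u]; rewrite size_map un; split=> //.
exact: uniq_oriented_trail.
Qed.

(** The bound of [prob_saw_ge] passes to the limit n = +oo by continuity of the
    probability along decreasing events. *)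
Lemma supercritical : (0 < P (@path_event d))%E.
Proof.
have msaw n : measurable (saw n (0 : vertex d)) := measurable_determined (@determined_saw d n 0).
have mI : measurable (\bigcap_n saw n (0 : vertex d)) by apply: bigcap_measurable.
set K := (2 * r ^+ shared_edges (0 : vertex d))^-1.
have K0 : 0 < K by rewrite invr_gt0 mulr_gt0 // exprn_gt0 // invr_gt0.
apply: (@lt_le_trans _ _ (K%:E)); first by rewrite lte_fin.
apply: (@le_trans _ _ (P (\bigcap_n saw n (0 : vertex d)))); last first.
  apply: le_measure; rewrite ?inE //; first exact: measurable_path_event.
  by rewrite path_eventE => w h; exists 0.
have noninc : nonincreasing_seq (fun n => saw n (0 : vertex d)).
  move=> m n mn; apply/subsetPset => w [s [sn us sw]].
  exists (take m s); rewrite take_trail size_takel ?sn // take_uniq //; split=> //.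
  by apply: all_closed_star_sub sw => y /mem_take.
have cvgP := nonincreasing_cvg_mu _ msaw mI noninc (mu := P).
have {}cvgP := cvgP (le_lt_trans (probability_le1 _ (msaw 0%N)) (ltry 1)).
rewrite -(cvg_lim _ cvgP) //; apply: lime_ge.
  by apply/cvg_ex; exists (P (\bigcap_n saw n (0 : vertex d))).
apply: nearW => n /=.
rewrite -(fineK (fin_num_measure P _ (msaw n))) lee_fin.
exact: prob_saw_ge.
Qed.
End Supercritical.

(** * Asymptotics of the threshold *)

Section Asymptotics.
Variables (R : realType) (d : nat) (eps : R).
Hypothesis eps01 : 0 < eps <= 1.
Let L : R := ln d%:R.
Hypothesis dlarge : 400 / eps <= L.

Let e0 : 0 < eps. Proof. by case/andP: eps01. Qed.
Let e1 : eps <= 1. Proof. by case/andP: eps01. Qed.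
Let eL : 400 <= eps * L. Proof. by rewrite mulrC -ler_pdivrMr. Qed.
Let L400 : 400 <= L.
Proof. by apply: le_trans dlarge; rewrite ler_pdivlMr // ler_piMr. Qed.
Let L0 : 0 < L. Proof. exact: lt_le_trans L400. Qed.
Let d0 : (0 < d)%N.
Proof. by rewrite lt0n; apply: contraTneq L0 => d0; rewrite /L d0 ln0 // ltxx. Qed.
Let dR0 : 0 < d%:R :> R. Proof. by rewrite ltr0n. Qed.
Let dE : d%:R = expR L. Proof. by rewrite lnK // posrE. Qed.
(* Square of expR (L / 2) >= L / 2. *)
Let dL2 : L ^+ 2 / 4 <= d%:R.
Proof.
rewrite dE; have -> : L = L / 2 + L / 2 by lra.
rewrite expRD -expr2; have h : L / 2 <= expR (L / 2).
  by rewrite (le_trans _ (expR_ge1Dx _)) //; lra.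
have -> : (L / 2 + L / 2) ^+ 2 / 4 = (L / 2) ^+ 2 by field.
by rewrite lerXn2r // nnegrE ?expR_ge0 // divr_ge0 // ltW.
Qed.
Let dL : L <= d%:R.
Proof.
apply: le_trans dL2; rewrite ler_pdivlMr // expr2 ler_pM2l //.
by apply: le_trans L400; lra.
Qed.

(** Here r ^ (2d + 2) is at most d ^ (1 - eps / 2), so that the first term of the
    overlap condition is at most 4 d ^ (- eps / 2), while the second one tends to 0
    with p. *)
Lemma supercritical_window : let p := (1 - eps) * (L / (2 * d%:R)) in
  0 <= p <= 1 /\ (0 < bernoulli_product (edge d) p (@path_event d))%E.
Proof.
move=> p; have [L400' eL' e0' e1'] := And4 L400 eL e0 e1.
have p0 : 0 <= p by rewrite mulr_ge0 ?subr_ge0 // divr_ge0 ?mulr_ge0 // ltW.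
have pL : p <= 2 / L.
  apply: (@le_trans _ _ (L / (2 * d%:R))).
    by rewrite ler_piMl ?divr_ge0 ?mulr_ge0 ?(ltW L0) // gerBl ltW.
  rewrite ler_pdivrMr ?mulr_gt0 // mulrAC ler_pdivlMr //.
  by have := dL2; rewrite ler_pdivrMr // expr2; lra.
have p200 : p <= 1 / 200.
  by apply: (le_trans pL); rewrite ler_pdivrMr //; lra.
have pe : p <= eps / 8.
  by apply: (le_trans pL); rewrite ler_pdivrMr //; lra.
split; first by rewrite p0 /=; lra.
have p1 : p < 1 by lra.
have q0 : 0 < 1 - p by lra.
have d8 : (8 <= d)%N by rewrite -(ler_nat R); have := dL; lra.
apply: supercritical => //; first by rewrite p0.
set r := (1 - p)^-1.
have rE : r = 1 + p / (1 - p) by rewrite /r; field; rewrite lt0r_neq0.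
(* The error factors (1 + 1 / d) and 1 / (1 - p) are absorbed by half of eps. *)
have rpow : r ^+ (2 * d).+2 <= expR ((1 - eps / 2) * L).
  apply: (@le_trans _ _ (expR (p / (1 - p)) ^+ (2 * d).+2)).
    by rewrite lerXn2r ?nnegrE ?expR_ge0 ?invr_ge0 ?(ltW q0) // rE; exact: expR_ge1Dx.
  rewrite -expRM_natl ler_expR mulrA ler_pdivrMr //.
  have d1 : 1 <= eps / 8 * d%:R.
    apply: (@le_trans _ _ (eps / 8 * L)); first by lra.
    by rewrite ler_pM2l ?divr_gt0.
  have -> : (2 * d).+2%:R * p = (1 - eps) * L * (1 + 1 / d%:R).
    by rewrite /p -[(2 * d).+2]addn2 natrD natrM; field; rewrite lt0r_neq0.
  have dinv : 1 / d%:R <= eps / 8 by rewrite ler_pdivrMr.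
  have dinv0 : 0 <= 1 / d%:R :> R by rewrite divr_ge0.
  rewrite mulrAC [leRHS]mulrAC ler_pM2r //.
  apply: (@le_trans _ _ ((1 - eps) * (1 + eps / 8))).
    by rewrite ler_wpM2l ?subr_ge0 // lerD2l.
  apply: (@le_trans _ _ ((1 - eps / 2) * (1 - eps / 8))); last by rewrite ler_wpM2l; lra.
  nra.
have first_term : (r ^+ (2 * d).+2 - 1) * (4 / d%:R) <= 1 / 4.
  apply: (@le_trans _ _ (expR ((1 - eps / 2) * L) * (4 / d%:R))).
    by rewrite ler_wpM2r ?divr_ge0 //; lra.
  rewrite mulrA ler_pdivrMr // dE.
  have -> : expR L = expR ((1 - eps / 2) * L) * expR (eps / 2 * L).
    by rewrite -expRD; congr expR; ring.
  rewrite mulrCA ler_pM2l ?expR_gt0 //.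
  by have := expR_ge1Dx (eps / 2 * L); lra.
have second_term : (r ^+ 2 - 1) * 21 <= 1 / 4.
  have q170 : 1 - 2 * p <= (1 - p) ^+ 2 by nra.
  suff : r ^+ 2 <= 85 / 84 by lra.
  rewrite /r exprVn invf_ple ?posrE ?exprn_gt0 //.
  rewrite invf_div; lra.
lra.
Qed.

(** The initial scale is r = d ^ 2 with k = 4 j, where j is the integer part of the
    square root of d: then d ^ 2 < (j + 1) ^ 4 <= 2 ^ k and k = o(d). *)
Lemma subcritical_window p : 0 <= p <= 1 -> (1 + eps) * (L / (2 * d%:R)) < p ->
  bernoulli_product (edge d) p (@path_event d) = 0%E.
Proof.
move=> p01 pL; have [L400' eL' e0' e1'] := And4 L400 eL e0 e1.
have ex : exists j, (j * j <= d)%N by exists 0%N.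
have ub j : (j * j <= d)%N -> (j <= d)%N by nia.
case: (ex_maxnP ex ub) => j jd jmax.
have dj : (d < j.+1 * j.+1)%N by rewrite ltnNge; apply/negP => /jmax; rewrite ltnn.
(* The logarithm compares to d through d >= L ^ 2 / 4 alone, and
   (L / 2) ^ 2 >= (8 / eps + 1) ^ 2 by the choice of 400. *)
have jlarge : 8 / eps <= j%:R.
  have h : (8 / eps + 1) ^+ 2 < (j%:R + 1) ^+ 2.
    apply: (@le_lt_trans _ _ d%:R); last first.
      by rewrite natr1 -natrX ltr_nat expnS expn1.
    apply: le_trans dL2; rewrite ler_pdivlMr //.
    have -> : 4 = 2 ^+ 2 :> R by rewrite -natrX.
    rewrite -exprMn lerXn2r ?nnegrE ?mulr_ge0 ?addr_ge0 ?divr_ge0 ?(ltW e0) ?(ltW L0) //.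
    apply: le_trans dlarge.
    have i1 : 1 <= 1 / eps by rewrite ler_pdivlMr ?mul1r.
    have -> : 400 / eps = 400 * (1 / eps) by rewrite mulrA mulr1.
    have -> : 8 / eps = 8 * (1 / eps) by rewrite mulrA mulr1.
    lra.
  rewrite leNgt; apply/negP => jl; move: h; rewrite ltNge; case/negP.
  by rewrite lerXn2r ?nnegrE ?addr_ge0 ?divr_ge0 ?(ltW e0) //; lra.
have r0 : (0 < d ^ 2)%N by rewrite expn_gt0 d0.
have rk : (d ^ 2 < 2 ^ (4 * j))%N.
  have h : (j.+1 <= 2 ^ j)%N by exact: ltn_expl.
  rewrite mulnC expnM.
  have h4 : (j.+1 ^ 4 <= (2 ^ j) ^ 4)%N by rewrite leq_exp2r.
  apply: leq_trans h4; rewrite -[4%N]/(2 * 2)%N expnM ltn_exp2r //.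
apply: (subcritical p01 d0 r0 rk).
case/andP: p01 => p0 p1.
have q0 : 0 <= 1 - p by rewrite subr_ge0.
have j0 : 0 < j%:R :> R by apply: lt_le_trans jlarge; rewrite divr_gt0.
have j2d : j%:R ^+ 2 <= d%:R :> R by rewrite -natrX ler_nat expnS expn1.
(* Discarding the 4 j correction costs a factor 1 - 2 j / d >= 1 - eps / 4. *)
have pbig : (1 + eps / 2) * L <= p * (2 * d - 4 * j)%:R.
  have j4d : (4 * j <= 2 * d)%N.
    have j8 : 8 <= j%:R :> R by apply: le_trans jlarge; rewrite ler_pdivlMr //; lra.
    by rewrite -(ler_nat R) !natrM; move: j2d; rewrite expr2; nra.
  apply: (@le_trans _ _ ((1 + eps) * (L / (2 * d%:R)) * (2 * d - 4 * j)%:R)); last first.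
    by rewrite ler_wpM2r // ltW.
  have jd4 : j%:R / d%:R <= eps / 8.
    rewrite ler_pdivrMr //; apply: (@le_trans _ _ (eps / 8 * j%:R ^+ 2)); last first.
      by rewrite ler_pM2l ?divr_gt0.
    by move: jlarge; rewrite ler_pdivrMr // => h; rewrite expr2; nra.
  rewrite natrB // !natrM.
  have -> : (1 + eps) * (L / (2 * d%:R)) * (2 * d%:R - 4 * j%:R) =
      (1 + eps) * (1 - 2 * (j%:R / d%:R)) * L by field; rewrite lt0r_neq0.
  rewrite ler_pM2r //; nra.
have q_le : (1 - p) ^+ ((2 * d - 4 * j) * (d ^ 2).+1) <=
    expR (- ((1 + eps / 2) * L)) ^+ (d ^ 2).
  rewrite exprM.
  have qe : (1 - p) ^+ (2 * d - 4 * j) <= expR (- ((1 + eps / 2) * L)).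
    apply: (@le_trans _ _ (expR (- p) ^+ (2 * d - 4 * j))).
      by rewrite lerXn2r ?nnegrE ?expR_ge0 //; exact: expR_ge1Dx.
    by rewrite -expRM_natr ler_expR mulNr lerN2.
  apply: (@le_trans _ _ (((1 - p) ^+ (2 * d - 4 * j)) ^+ (d ^ 2))).
    apply: ler_wiXn2l; [by rewrite exprn_ge0|by rewrite exprn_ile1 // gerBl|exact: leqnSn].
  by rewrite lerXn2r ?nnegrE ?exprn_ge0 ?expR_ge0.
(* Each factor is now bounded by an exponential; any crude constants do, because the
   final exponent is dominated by - d ^ 2 * eps * L / 2. *)
have c45 : 45 <= expR 44 :> R by apply: le_trans (expR_ge1Dx 44); lra.
have c2 : 2 <= expR 1 :> R by apply: le_trans (expR_ge1Dx 1); lra.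
have f1 : ((45 * d ^ 2) ^ d)%:R <= expR (44 + 2 * L) ^+ d.
  rewrite natrX lerXn2r ?nnegrE ?expR_ge0 // natrM natrX expRD ler_pM ?exprn_ge0 //.
  by rewrite dE -expRM_natl.
have f2 : (2 * d)%:R ^+ (d ^ 2) <= expR (1 + L) ^+ (d ^ 2).
  by rewrite lerXn2r ?nnegrE ?expR_ge0 // natrM expRD dE ler_pM ?expR_ge0.
apply: (@le_trans _ _ (expR (44 + 2 * L) ^+ d *
    (expR (1 + L) ^+ (d ^ 2) * expR (- ((1 + eps / 2) * L)) ^+ (d ^ 2)))).
  by rewrite ler_pM ?mulr_ge0 ?exprn_ge0 // ler_pM ?exprn_ge0.
rewrite -!expRM_natl -!expRD -[leRHS]expR0 ler_expR natrX.
have -> : d%:R * (44 + 2 * L) + (d%:R ^+ 2 * (1 + L) + d%:R ^+ 2 * - ((1 + eps / 2) * L)) =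
   d%:R * (44 + 2 * L - d%:R * (eps / 2 * L - 1)) by ring.
rewrite pmulr_rle0 //.
have eLd : 3 * L <= d%:R * (eps / 4 * L).
  rewrite mulrA ler_pM2r //.
  have : eps * L <= eps * d%:R by rewrite ler_pM2l.
  lra.
have : d%:R * (eps / 4 * L) <= d%:R * (eps / 2 * L - 1) by rewrite ler_pM2l //; lra.
lra.
Qed.
End Asymptotics.

Theorem corollary1p3 (R : realType) :
  (fun d : nat => p_shield R d / (ln d%:R / (2 * d%:R))) @ \oo --> (1 : R).
Proof.
apply/cvgrPdist_le => e e_gt0.
pose eps : R := Num.min e 1.
have eps01 : 0 < eps <= 1 by rewrite /eps lt_min e_gt0 ltr01 /= ge_min lexx orbT.
have epse : eps <= e by rewrite /eps ge_min lexx.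
have dl0 : 0 < 400 / eps by case/andP: eps01 => e0 _; rewrite divr_gt0.
(* All estimates need only ln d >= 400 / eps. *)
exists (Num.truncn (expR (400 / eps))).+1 => // d /= dN.
have dbig : expR (400 / eps) <= d%:R.
  by apply/ltW/(lt_le_trans (truncnS_gt _)); rewrite ler_nat.
have dR0 : 0 < d%:R :> R by apply: lt_le_trans dbig; exact: expR_gt0.
have dlarge : 400 / eps <= ln d%:R.
  by rewrite -ler_expR lnK // posrE.
have l0 : 0 < ln d%:R / (2 * d%:R) :> R.
  by rewrite divr_gt0 ?mulr_gt0 // (lt_le_trans dl0).
set l := ln d%:R / (2 * d%:R) in l0 *.
have [p01 pos] := supercritical_window eps01 dlarge; rewrite -/l in p01 pos.
pose A := [set p : R | 0 <= p <= 1 /\ (0 < bernoulli_product (edge d) p (@path_event d))%E].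
have upA : ubound A ((1 + eps) * l).
  move=> p [pp ppos]; rewrite leNgt; apply/negP => lp.
  by move: ppos; rewrite (subcritical_window eps01 dlarge pp lp) ltxx.
have lo : (1 - eps) * l <= p_shield R d.
  by apply: (ub_le_sup (E := A)); [exists ((1 + eps) * l)|split].
have hi : p_shield R d <= (1 + eps) * l.
  by apply: (ge_sup (E := A)) => //; exists ((1 - eps) * l).
apply: le_trans epse; rewrite distrC ler_distl ler_pdivlMr // ler_pdivrMr //.
by rewrite lo.
Qed.
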